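(* Let $0\le\gamma_1,\gamma_2<2\pi$ and let $f_k\in S^0(H_{\gamma_k})$ for $k=1,2$. If the harmonic convolution $f_1*f_2$ is locally univalent in $\mathbb{D}$, then $f_1*f_2$ is convex in the direction $-(\gamma_1+\gamma_2)$.
   Context: $\mathbb{D}$ is the open unit disk in $\mathbb{C}$. A complex-valued harmonic function $f$ on $\mathbb{D}$ with $f(0)=0$ is written $f=h+\overline{g}$ with $h,g$ analytic in $\mathbb{D}$ and $h(0)=g(0)=0$. It is called locally univalent (equivalently, it satisfies the dilatation condition) if $|g'(z)|<|h'(z)|$ for all $z\in\mathbb{D}$ (this includes being sense-preserving). $S_H^O$ is the class of complex-valued, harmonic, sense-preserving, univalent functions $f$ on $\mathbb{D}$ with $f(0)=0$, $f_z(0)=1$, $f_{\overline z}(0)=0$ (i.e. $h'(0)=1$, $g'(0)=0$). For $0\le\gamma<2\pi$, $H_\gamma=\{w\in\mathbb{C}:\operatorname{Re}(e^{i\gamma}w)>-\tfrac12\}$, and $S^0(H_\gamma)\subset S_H^O$ is the class of $f\in S_H^O$ that map $\mathbb{D}$ onto $H_\gamma$. Harmonic convolution: if $f_1=h_1+\overline{g_1}$ and $f_2=h_2+\overline{g_2}$, then $f_1*f_2=h_1*h_2+\overline{g_1*g_2}$, where for analytic functions $\left(\sum_{n\ge1} a_nz^n\right)*\left(\sum_{n\ge1} A_nz^n\right)=\sum_{n\ge1} a_nA_nz^n$. A domain $\Omega\subset\mathbb{C}$ is convex in the direction $\varphi\in\mathbb{R}$ if every line parallel to the line through $0$ and $e^{i\varphi}$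 has connected or empty intersection with $\Omega$. A function on $\mathbb{D}$ is convex in the direction $\varphi$ if it is univalent on $\mathbb{D}$ and its image is a domain convex in the direction $\varphi$. *)

(* Defs.v *)
From Stdlib Require Import Reals.
From Coquelicot Require Import Coquelicot.

Open Scope R_scope.

(* Functions on the disk are total functions [C -> C]; every notion below only
   depends on their values on [disk], which is open. *)
Definition disk (z : C) : Prop := Cmod z < 1.

Definition cis (t : R) : C := (cos t, sin t).

Definition image (f : C -> C) (w : C) : Prop := exists z, disk z /\ f z = w.

Definition univalent (f : C -> C) : Prop :=
  forall z w, disk z -> disk w -> f z = f w -> z = w.

Definition analytic (h : C -> C) : Prop :=
  forall z, disk z -> ex_derive (h : C_AbsRing -> C_NormedModule) z.

Definition dx (u : C -> R) (z : C) : R := Derive (fun t => u (t, Im z)) (Re z).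
Definition dy (u : C -> R) (z : C) : R := Derive (fun t => u (Re z, t)) (Im z).

Definition continuously_differentiable (u : C -> R) : Prop :=
  forall z, disk z ->
    ex_derive (fun t => u (t, Im z)) (Re z) /\
    ex_derive (fun t => u (Re z, t)) (Im z) /\
    continuous (dx u) z /\ continuous (dy u) z.

Definition real_harmonic (u : C -> R) : Prop :=
  continuously_differentiable u /\
  continuously_differentiable (dx u) /\ continuously_differentiable (dy u) /\
  forall z, disk z -> dx (dx u) z + dy (dy u) z = 0.

Definition harmonic (f : C -> C) : Prop :=
  real_harmonic (fun z => Re (f z)) /\ real_harmonic (fun z => Im (f z)).

Definition Cdx (f : C -> C) (z : C) : C :=
  (dx (fun w => Re (f w)) z, dx (fun w => Im (f w)) z).
Definition Cdy (f : C -> C) (z : C) : C :=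
  (dy (fun w => Re (f w)) z, dy (fun w => Im (f w)) z).

(* The Wirtinger derivatives f_z and f_zbar. *)
Definition d_z (f : C -> C) (z : C) : C := ((Cdx f z - Ci * Cdy f z) / 2)%C.
Definition d_zbar (f : C -> C) (z : C) : C := ((Cdx f z + Ci * Cdy f z) / 2)%C.

(* The Jacobian of f is |f_z|^2 - |f_zbar|^2. *)
Definition sense_preserving (f : C -> C) : Prop :=
  forall z, disk z -> Cmod (d_zbar f z) < Cmod (d_z f z).

(* f = h + conj g, normalized by h(0) = g(0) = 0; h and g are then uniquely
   determined on the disk by f. *)
Definition analytic_parts (f h g : C -> C) : Prop :=
  analytic h /\ analytic g /\ h 0%C = 0%C /\ g 0%C = 0%C /\
  forall z, disk z -> f z = (h z + Cconj (g z))%C.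

(* The dilatation condition |g'| < |h'|. *)
Definition locally_univalent (f : C -> C) : Prop :=
  exists h g, analytic_parts f h g /\
    forall z, disk z -> Cmod (C_derive g z) < Cmod (C_derive h z).

Definition S_H_O (f : C -> C) : Prop :=
  harmonic f /\ sense_preserving f /\ univalent f /\
  f 0%C = 0%C /\ d_z f 0%C = 1%C /\ d_zbar f 0%C = 0%C.

Definition half_plane (gamma : R) (w : C) : Prop :=
  Re (cis gamma * w)%C > - (1 / 2).

Definition S0_half_plane (gamma : R) (f : C -> C) : Prop :=
  S_H_O f /\ forall w, image f w <-> half_plane gamma w.

Definition power_series (a : nat -> C) (h : C -> C) : Prop :=
  forall z : C, disk z ->
    is_pseries (K := C_AbsRing) (V := C_NormedModule) a z (h z).

(* h = h1 * h2 on the disk. Series start at n = 0; when h1(0) = h2(0) = 0 the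
   terms of index 0 vanish. *)
Definition is_conv (h1 h2 h : C -> C) : Prop :=
  exists a A : nat -> C,
    power_series a h1 /\ power_series A h2 /\
    power_series (fun n => (a n * A n)%C) h.

(* f = f1 * f2 on the disk. The relation determines f there, and such an f
   exists for all f1, f2 harmonic on the disk with f1(0) = f2(0) = 0. *)
Definition is_harmonic_conv (f1 f2 f : C -> C) : Prop :=
  exists h1 g1 h2 g2 h g,
    analytic_parts f1 h1 g1 /\ analytic_parts f2 h2 g2 /\
    is_conv h1 h2 h /\ is_conv g1 g2 g /\
    forall z, disk z -> f z = (h z + Cconj (g z))%C.

Definition connected (S : C -> Prop) : Prop :=
  forall U V : C -> Prop, open U -> open V ->
    (forall w, S w -> U w \/ V w) ->
    (forall w, ~ (S w /\ U w /\ V w)) ->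
    (forall w, S w -> U w) \/ (forall w, S w -> V w).

Definition domain (S : C -> Prop) : Prop :=
  (exists w, S w) /\ open S /\ connected S.

(* The line through p parallel to the line through 0 and cis phi. *)
Definition line (phi : R) (p w : C) : Prop :=
  exists t : R, w = (p + RtoC t * cis phi)%C.

(* The empty set is [connected]. *)
Definition set_convex_in_direction (phi : R) (S : C -> Prop) : Prop :=
  forall p, connected (fun w => S w /\ line phi p w).

Definition convex_in_direction (phi : R) (f : C -> C) : Prop :=
  univalent f /\ domain (image f) /\ set_convex_in_direction phi (image f).

(* Main.v *)
Require Import Defs.
From Stdlib Require Import Reals Lra Lia Classical ClassicalEpsilon.
From Coquelicot Require Import Coquelicot.

(* Write f_k = h_k + conj g_k, e_k = exp(i gamma_k), e = e_1 e_2.  Since f_k maps into H_{gamma_k}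
   and is normalized at 0, the analytic function h_k + conj(e_k)^2 g_k is extremal for the Schwarz
   lemma, so it equals z / (1 - e_k z), with Taylor coefficients e_k^(n-1).  Hence, writing h and g
   for the convolutions h_1 * h_2 and g_1 * g_2,
     2 (h' - conj(e)^2 g')(z)
       = (h_2' - conj(e_2)^2 g_2')(e_1 z) + (h_1' - conj(e_1)^2 g_1')(e_2 z),
   and the dilatation conditions on f_1 and f_2 show that P = (h' - conj(e)^2 g') (1 - e z)^2
   satisfies Re P > 0.

   In the variable w = e z / (1 - e z), which ranges over Re w > -1/2, the function
   K = e (h - conj(e)^2 g) has derivative P.  Therefore Im K is increasing on vertical lines, and a
   maximum principle on tall rectangles shows that a level set Im K = c is a graph over an interval
   of the real axis.  As Im K = Im (e f), and Re (e f) is increasing along these graphs because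
   |g'| < |h'|, the function e f is injective and its image meets horizontal lines in intervals. *)

(** * Complex derivatives *)

(** The sign in [h - conj(e)^2 g] comes from [Im (e conj(g)) = - Im (conj(e) g)], while
    [Re (e_k conj(g_k)) = Re (conj(e_k) g_k)] gives the plus sign in the functions to which the
    Schwarz lemma applies. The factor [(1 - e z)^2] in P is [e dz/dw].

    The half-plane is preferred to the disk because it contains whole vertical lines. The obstacle
    there is that [Im K] may be bounded on such a line, so a level set need not meet all of them;
    what must be excluded is that it misses a line lying between two that it meets. As nothing is
    known near [Re w = -1/2], the comparison is made on rectangles inside the half-plane.

    Harmonicity is used only through second derivatives at a minimum. It is therefore enough that
    every function involved has two complex derivatives, which power series have by termwise
    differentiation; no contour integral occurs. *)

Definition cderive (f : C -> C) (z l : C) : Prop :=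
  is_derive (K := C_AbsRing) (V := C_NormedModule) f z l.

(** [C_NormedModule] and the module structure of [C_AbsRing] over itself share operations and norm
    but are different terms; the general rules for the identity, products and inner functions are
    stated for the latter. *)
Lemma cderive_abs_ring (f : C -> C) (z l : C) :
  cderive f z l <-> @is_derive C_AbsRing (AbsRing_NormedModule C_AbsRing) f z l.
Proof.
  split; intros [[H1 H2 H3] H]; (split; [constructor; [exact H1 | exact H2 | exact H3] | exact H]).
Qed.

Lemma cderive_eps (f : C -> C) (z l : C) :
  cderive f z l <->
  forall eps, 0 < eps -> exists d, 0 < d /\
    forall w, Cmod (w - z) < d -> Cmod (f w - f z - (w - z) * l) <= eps * Cmod (w - z).
Proof.
  split.
  - intros [_ H] eps He.
    destruct (H z (fun P HP => HP) (mkposreal _ He)) as [d Hd].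
    exists d. split; [apply cond_pos |]. intros w Hw. apply (Hd w). exact Hw.
  - intros H. split; [apply is_linear_scal_l |]. intros y Hy.
    assert (z = y).
    { apply (is_filter_lim_locally_unique (K := C_AbsRing) (V := AbsRing_NormedModule C_AbsRing)).
      exact Hy. }
    subst y. intros eps. destruct (H eps (cond_pos eps)) as [d [Hd H']].
    exists (mkposreal d Hd). intros w Hw. apply H'. exact Hw.
Qed.

Lemma cderive_ext_loc (f g : C -> C) (z l : C) (d : R) :
  0 < d -> (forall w, Cmod (w - z) < d -> f w = g w) -> cderive f z l -> cderive g z l.
Proof.
  intros Hd He Hf. apply cderive_eps. intros eps Heps.
  destruct (proj1 (cderive_eps f z l) Hf eps Heps) as [e [Hpos H]].
  exists (Rmin d e). split; [now apply Rmin_pos |]. intros w Hw.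
  rewrite <- (He w), <- (He z); [apply H | |].
  - eapply Rlt_le_trans; [exact Hw | apply Rmin_r].
  - replace (z - z)%C with (RtoC 0) by ring. now rewrite Cmod_0.
  - eapply Rlt_le_trans; [exact Hw | apply Rmin_l].
Qed.

Lemma cderive_unique (f : C -> C) (z l m : C) : cderive f z l -> cderive f z m -> l = m.
Proof.
  intros H1 H2. transitivity (C_derive f z); [symmetry |]; now apply is_C_derive_unique.
Qed.

Lemma cderive_const (c z : C) : cderive (fun _ => c) z 0%C.
Proof. exact (is_derive_const (K := C_AbsRing) (V := C_NormedModule) c z). Qed.

Lemma cderive_id (z : C) : cderive (fun w => w) z 1%C.
Proof. apply cderive_abs_ring. exact (is_derive_id (K := C_AbsRing) z). Qed.

Lemma cderive_plus (f g : C -> C) (z l m : C) :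
  cderive f z l -> cderive g z m -> cderive (fun w => f w + g w)%C z (l + m)%C.
Proof. exact (is_derive_plus (K := C_AbsRing) (V := C_NormedModule) f g z l m). Qed.

Lemma cderive_opp (f : C -> C) (z l : C) :
  cderive f z l -> cderive (fun w => - f w)%C z (- l)%C.
Proof. exact (is_derive_opp (K := C_AbsRing) (V := C_NormedModule) f z l). Qed.

Lemma cderive_minus (f g : C -> C) (z l m : C) :
  cderive f z l -> cderive g z m -> cderive (fun w => f w - g w)%C z (l - m)%C.
Proof. exact (is_derive_minus (K := C_AbsRing) (V := C_NormedModule) f g z l m). Qed.

Lemma cderive_mult (f g : C -> C) (z l m : C) :
  cderive f z l -> cderive g z m -> cderive (fun w => f w * g w)%C z (l * g z + f z * m)%C.
Proof.
  intros H1 H2. apply cderive_abs_ring.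
  exact (@is_derive_mult C_AbsRing f g z l m (proj1 (cderive_abs_ring _ _ _) H1)
           (proj1 (cderive_abs_ring _ _ _) H2) Cmult_comm).
Qed.

Lemma cderive_comp (f g : C -> C) (z l m : C) :
  cderive f (g z) l -> cderive g z m -> cderive (fun w => f (g w)) z (m * l)%C.
Proof.
  intros H1 H2. exact (@is_derive_comp C_AbsRing C_NormedModule f g z l m H1
                         (proj1 (cderive_abs_ring _ _ _) H2)).
Qed.

Lemma cderive_scal (c : C) (f : C -> C) (z l : C) :
  cderive f z l -> cderive (fun w => c * f w)%C z (c * l)%C.
Proof.
  intros H. replace (c * l)%C with (0 * f z + c * l)%C by ring.
  apply (cderive_mult (fun _ => c)); [apply cderive_const | exact H].
Qed.

Lemma cderive_Cinv (a : C) : a <> 0%C -> cderive Cinv a (- / (a * a))%C.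
Proof.
  intros Ha. apply cderive_eps. intros eps Heps.
  assert (Hm : 0 < Cmod a) by now apply Cmod_gt_0.
  assert (Hm2 : 0 < eps * (Cmod a) ^ 3 / 2).
  { assert (0 < Cmod a ^ 3) by now apply pow_lt. nra. }
  (* The remainder is [(w - a)^2 / (a^2 w)]. The first radius gives [|w| > |a| / 2], hence a bound
     [2 |w - a|^2 / |a|^3]; the second makes this at most [eps |w - a|]. *)
  exists (Rmin (Cmod a / 2) (eps * (Cmod a) ^ 3 / 2)). split; [apply Rmin_pos; lra |].
  intros w Hw.
  assert (H1 : Cmod (w - a) < Cmod a / 2) by (eapply Rlt_le_trans; [exact Hw | apply Rmin_l]).
  assert (H2 : Cmod (w - a) < eps * (Cmod a) ^ 3 / 2)
    by (eapply Rlt_le_trans; [exact Hw | apply Rmin_r]).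
  assert (H3 : Cmod a / 2 < Cmod w).
  { pose proof (Cmod_triangle w (- (w - a))) as T. rewrite Cmod_opp in T.
    replace (w + - (w - a))%C with a in T by ring. lra. }
  assert (Hw0 : w <> 0%C) by (apply Cmod_gt_0; lra).
  replace (/ w - / a - (w - a) * - / (a * a))%C with ((w - a) * ((w - a) / (a * a * w)))%C
    by (field; auto).
  rewrite Cmod_mult, Rmult_comm. apply Rmult_le_compat_r; [apply Cmod_ge_0 |].
  rewrite Cmod_div, !Cmod_mult; [| repeat apply Cmult_neq_0; auto].
  apply Rlt_le, (Rmult_lt_reg_r (Cmod a * Cmod a * Cmod w)).
  { repeat apply Rmult_lt_0_compat; lra. }
  unfold Rdiv. rewrite Rmult_assoc, Rinv_l, Rmult_1_r.
  2: { apply Rgt_not_eq; repeat apply Rmult_lt_0_compat; lra. }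
  assert (0 < eps * (Cmod a * Cmod a)) by (repeat apply Rmult_lt_0_compat; lra).
  nra.
Qed.

Lemma cderive_inv (f : C -> C) (z l : C) :
  f z <> 0%C -> cderive f z l -> cderive (fun w => / f w)%C z (- l / (f z * f z))%C.
Proof.
  intros Hz H. replace (- l / (f z * f z))%C with (l * - / (f z * f z))%C.
  - apply (cderive_comp Cinv f); [now apply cderive_Cinv | exact H].
  - field. auto.
Qed.

Lemma cderive_div (f g : C -> C) (z l m : C) :
  g z <> 0%C -> cderive f z l -> cderive g z m ->
  cderive (fun w => f w / g w)%C z ((l * g z - f z * m) / (g z * g z))%C.
Proof.
  intros Hz Hf Hg.
  replace ((l * g z - f z * m) / (g z * g z))%C
    with (l * / g z + f z * (- m / (g z * g z)))%C by (field; auto).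
  apply (cderive_mult f (fun w => / g w)%C); [exact Hf | now apply cderive_inv].
Qed.

Lemma cderive_lipschitz (f : C -> C) (z l : C) :
  cderive f z l -> exists M d, 0 < M /\ 0 < d /\
    forall w, Cmod (w - z) < d -> Cmod (f w - f z) <= M * Cmod (w - z).
Proof.
  intros H. destruct (proj1 (cderive_eps f z l) H 1 Rlt_0_1) as [d [Hd Hw]].
  exists (1 + Cmod l), d. pose proof (Cmod_ge_0 l). split; [lra |]. split; [exact Hd |].
  intros w Hwd. specialize (Hw w Hwd).
  pose proof (Cmod_triangle (f w - f z - (w - z) * l) ((w - z) * l)) as T.
  replace (f w - f z - (w - z) * l + (w - z) * l)%C with (f w - f z)%C in T by ring.
  rewrite Cmod_mult in T. lra.
Qed.

Definition ccontinuous (f : C -> C) (z : C) : Prop :=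
  forall eps, 0 < eps -> exists d, 0 < d /\ forall w, Cmod (w - z) < d -> Cmod (f w - f z) < eps.

Lemma cderive_continuous (f : C -> C) (z l : C) : cderive f z l -> ccontinuous f z.
Proof.
  intros H eps He. destruct (cderive_lipschitz f z l H) as [M [d [HM [Hd Hw]]]].
  assert (0 < eps / M) by now apply Rdiv_lt_0_compat.
  exists (Rmin d (eps / M)). split; [now apply Rmin_pos |]. intros w Hlt.
  apply Rle_lt_trans with (M * Cmod (w - z)).
  - apply Hw. eapply Rlt_le_trans; [exact Hlt | apply Rmin_l].
  - apply (Rmult_lt_reg_r (/ M)); [now apply Rinv_0_lt_compat |].
    replace (M * Cmod (w - z) * / M) with (Cmod (w - z)) by (field; lra).
    eapply Rlt_le_trans; [exact Hlt | apply Rmin_r].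
Qed.

Lemma im_le_Cmod (z : C) : Rabs (Im z) <= Cmod z.
Proof. eapply Rle_trans; [apply Rmax_r | apply Rmax_Cmod]. Qed.

Lemma Cmod_le_abs (z : C) : Cmod z <= Rabs (Re z) + Rabs (Im z).
Proof.
  destruct z as [x y]. replace ((x, y) : C) with (RtoC x + Ci * RtoC y)%C.
  - eapply Rle_trans; [apply Cmod_triangle |].
    rewrite Cmod_mult, Cmod_Ci, !Cmod_R. simpl.
    replace (x + (0 * y - 1 * 0)) with x by ring. replace (0 + (0 * 0 + 1 * y)) with y by ring. lra.
  - apply injective_projections; simpl; ring.
Qed.

Lemma Cmod_sub_sym (z w : C) : Cmod (z - w) = Cmod (w - z).
Proof. rewrite <- Cmod_opp. f_equal. ring. Qed.

Lemma is_derive_eps (f : R -> R) (t l : R) :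
  is_derive f t l <->
  forall eps, 0 < eps -> exists d, 0 < d /\
    forall s, Rabs (s - t) < d -> Rabs (f s - f t - (s - t) * l) <= eps * Rabs (s - t).
Proof.
  split.
  - intros [_ H] eps He.
    destruct (H t (fun P HP => HP) (mkposreal _ He)) as [d Hd].
    exists d. split; [apply cond_pos |]. intros w Hw. apply (Hd w). exact Hw.
  - intros H. split; [apply is_linear_scal_l |]. intros y Hy.
    assert (t = y).
    { apply (is_filter_lim_locally_unique (K := R_AbsRing) (V := AbsRing_NormedModule R_AbsRing)).
      exact Hy. }
    subst y. intros eps. destruct (H eps (cond_pos eps)) as [d [Hd H']].
    exists (mkposreal d Hd). intros w Hw. apply H'. exact Hw.
Qed.

Lemma cderive_curve (f : C -> C) (p l : C) (x y : R -> R) (dx dy t0 : R) :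
  is_derive x t0 dx -> is_derive y t0 dy -> p = (x t0, y t0) -> cderive f p l ->
  is_derive (fun t => Re (f (x t, y t))) t0 (Re (l * (dx, dy))%C).
Proof.
  intros Hx Hy -> Hf. apply is_derive_eps. intros eps He.
  (* [B] bounds the speed of the curve near [t0] and [N] bounds [|l|]. The error of [f] along the
     curve and the error of the curve multiplied by [l] then cost [eps / 2] each. *)
  set (B := Rabs dx + Rabs dy + 2).
  assert (HB : 2 <= B) by (unfold B; pose proof (Rabs_pos dx); pose proof (Rabs_pos dy); lra).
  set (N := Cmod l + 1). assert (HN : 1 <= N) by (unfold N; pose proof (Cmod_ge_0 l); lra).
  assert (Ha : 0 < eps / (2 * B)) by (apply Rdiv_lt_0_compat; lra).
  assert (Hb : 0 < Rmin 1 (eps / (4 * N))).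
  { apply Rmin_pos; [lra |]. apply Rdiv_lt_0_compat; lra. }
  destruct (proj1 (cderive_eps _ _ _) Hf _ Ha) as [d [Hd Hw]].
  destruct (proj1 (is_derive_eps _ _ _) Hx _ Hb) as [d1 [Hd1 Hx1]].
  destruct (proj1 (is_derive_eps _ _ _) Hy _ Hb) as [d2 [Hd2 Hy2]].
  exists (Rmin (d / B) (Rmin d1 d2)). split.
  { repeat apply Rmin_pos; try assumption. apply Rdiv_lt_0_compat; lra. }
  intros s Hs.
  assert (Hs0 : Rabs (s - t0) < d / B) by (eapply Rlt_le_trans; [exact Hs | apply Rmin_l]).
  assert (Hs1 : Rabs (s - t0) < d1).
  { eapply Rlt_le_trans; [exact Hs |]. eapply Rle_trans; [apply Rmin_r | apply Rmin_l]. }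
  assert (Hs2 : Rabs (s - t0) < d2).
  { eapply Rlt_le_trans; [exact Hs |]. eapply Rle_trans; [apply Rmin_r | apply Rmin_r]. }
  specialize (Hx1 s Hs1). specialize (Hy2 s Hs2).
  set (h := Rabs (s - t0)) in *. assert (Hh : 0 <= h) by apply Rabs_pos.
  set (m := Rmin 1 (eps / (4 * N))) in *.
  assert (Hm1 : m <= 1) by apply Rmin_l. assert (Hm2 : m <= eps / (4 * N)) by apply Rmin_r.
  assert (Gx : Rabs (x s - x t0) <= (Rabs dx + 1) * h).
  { replace (x s - x t0) with ((x s - x t0 - (s - t0) * dx) + (s - t0) * dx) by ring.
    eapply Rle_trans; [apply Rabs_triang |]. rewrite (Rabs_mult (s - t0)). fold h. nra. }
  assert (Gy : Rabs (y s - y t0) <= (Rabs dy + 1) * h).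
  { replace (y s - y t0) with ((y s - y t0 - (s - t0) * dy) + (s - t0) * dy) by ring.
    eapply Rle_trans; [apply Rabs_triang |]. rewrite (Rabs_mult (s - t0)). fold h. nra. }
  set (D := (((x s, y s) : C) - (x t0, y t0))%C) in *.
  assert (HD : Cmod D <= B * h).
  { eapply Rle_trans; [apply Cmod_le_abs |]. unfold D, Re, Im; simpl. unfold Rminus in Gx, Gy.
    unfold B. lra. }
  assert (HDd : Cmod D < d).
  { eapply Rle_lt_trans; [exact HD |]. replace d with (B * (d / B)) by (field; lra).
    apply Rmult_lt_compat_l; lra. }
  specialize (Hw _ HDd). fold D in Hw.
  set (A := (f (x s, y s) - f (x t0, y t0) - D * l)%C) in *.
  set (E := ((x s - x t0 - (s - t0) * dx, y s - y t0 - (s - t0) * dy) : C)).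
  assert (HE : Cmod E <= 2 * m * h).
  { eapply Rle_trans; [apply Cmod_le_abs |]. unfold E, Re, Im; simpl. lra. }
  replace (Re (f (x s, y s)) - Re (f (x t0, y t0)) - (s - t0) * Re (l * (dx, dy))%C)
    with (Re (A + E * l)%C).
  2: { unfold A, D, E, Re; simpl. ring. }
  eapply Rle_trans; [apply re_le_Cmod |]. eapply Rle_trans; [apply Cmod_triangle |].
  rewrite Cmod_mult.
  assert (H1 : Cmod A <= eps / 2 * h).
  { eapply Rle_trans; [exact Hw |]. replace (eps / 2 * h) with (eps / (2 * B) * (B * h)) by (field; lra).
    apply Rmult_le_compat_l; lra. }
  assert (H2 : Cmod E * Cmod l <= eps / 2 * h).
  { apply Rle_trans with (2 * m * h * N).
    - apply Rmult_le_compat; try apply Cmod_ge_0; [exact HE | unfold N; lra].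
    - replace (eps / 2 * h) with (2 * (eps / (4 * N)) * h * N) by (field; lra).
      apply Rmult_le_compat_r; [lra |]. apply Rmult_le_compat_r; [exact Hh | lra]. }
  lra.
Qed.

(** Transfers statements about real parts to imaginary parts, by passing from [f] to [- Ci * f]. *)
Lemma Re_mult_opp_Ci (z : C) : Re (- Ci * z)%C = Im z.
Proof. unfold Re, Im; simpl. ring. Qed.

Lemma cderive_horizontal (f : C -> C) (p l : C) :
  cderive f p l ->
  is_derive (fun t : R => Re (f (t, Im p))) (Re p) (Re l) /\
  is_derive (fun t : R => Im (f (t, Im p))) (Re p) (Im l).
Proof.
  intros H.
  assert (K : forall f l, cderive f p l ->
            is_derive (fun t : R => Re (f (t, Im p))) (Re p) (Re l)).
  { intros k m Hk.
    pose proof (cderive_curve k p m (fun t => t) (fun _ => Im p) _ _ (Re p) (is_derive_id _)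
                  (is_derive_const _ _) ltac:(now destruct p) Hk) as D.
    replace (Re m) with (Re (m * (1, 0))%C) by (unfold Re; simpl; ring). exact D. }
  split; [now apply K |].
  rewrite <- (Re_mult_opp_Ci l).
  eapply is_derive_ext; [| apply (K (fun w => - Ci * f w)%C); now apply cderive_scal].
  intros t. apply Re_mult_opp_Ci.
Qed.

Lemma cderive_vertical (f : C -> C) (p l : C) :
  cderive f p l ->
  is_derive (fun t : R => Re (f (Re p, t))) (Im p) (- Im l) /\
  is_derive (fun t : R => Im (f (Re p, t))) (Im p) (Re l).
Proof.
  intros H.
  assert (K : forall f l, cderive f p l ->
            is_derive (fun t : R => Re (f (Re p, t))) (Im p) (- Im l)).
  { intros k m Hk.
    pose proof (cderive_curve k p m (fun _ => Re p) (fun t => t) _ _ (Im p) (is_derive_const _ _)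
                  (is_derive_id _) ltac:(now destruct p) Hk) as D.
    replace (- Im m) with (Re (m * (0, 1))%C) by (unfold Re, Im; simpl; ring). exact D. }
  split; [now apply K |].
  replace (Re l) with (- Im (- Ci * l)%C) by (unfold Re, Im; simpl; ring).
  eapply is_derive_ext; [| apply (K (fun w => - Ci * f w)%C); now apply cderive_scal].
  intros t. apply Re_mult_opp_Ci.
Qed.

Lemma cderive_conj_conj (f : C -> C) (z l : C) :
  cderive f (Cconj z) l -> cderive (fun w => Cconj (f (Cconj w))) z (Cconj l).
Proof.
  intros H. apply cderive_eps. intros eps He.
  destruct (proj1 (cderive_eps _ _ _) H eps He) as [d [Hd Hw]].
  exists d. split; [exact Hd |]. intros w Hlt.
  specialize (Hw (Cconj w)). rewrite <- Cminus_conj, Cmod_conj in Hw. specialize (Hw Hlt).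
  rewrite <- Cminus_conj, <- (Cconj_conj (w - z)), <- Cmult_conj, <- Cminus_conj, Cmod_conj.
  rewrite Cconj_conj. exact Hw.
Qed.

(** * Compactness and the Laplacian at a minimum *)

Definition compact_set (K : C -> Prop) : Prop :=
  (exists M, forall p, K p -> Cmod p <= M) /\
  (forall p, ~ K p -> exists d, 0 < d /\ forall q, Cmod (q - p) < d -> ~ K q).

(** Compactness in gauge form: [d] plays the role of the least radius in a finite subcover by balls
    [|q - p| < delta p]. *)
Lemma compact_gauge (K : C -> Prop) (delta : C -> R) :
  compact_set K -> (forall p, K p -> 0 < delta p) ->
  exists d, 0 < d /\
    forall q, K q -> exists p, K p /\ Cmod (q - p) < delta p /\ d <= delta p.
Proof.
  intros [[M HM] Hcl] Hdelta.
  (* The gauge is extended to a square around [K] by radii whose balls miss [K]. Radii are halved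
     because coordinates within [e] only give a distance below [2 * e]. *)
  assert (Hg : forall u v, exists e : posreal,
    (K (u, v) -> e <= delta (u, v) / 2) /\
    (~ K (u, v) -> forall q, Cmod (q - (u, v)) < 2 * e -> ~ K q)).
  { intros u v. destruct (classic (K (u, v))) as [H | H].
    - assert (Hp : 0 < delta (u, v) / 2) by (specialize (Hdelta _ H); lra).
      exists (mkposreal _ Hp). split; [intros _; apply Rle_refl | intros; contradiction].
    - destruct (Hcl _ H) as [d [Hd Hq]]. assert (Hp : 0 < d / 2) by lra.
      exists (mkposreal _ Hp). split; [intros; contradiction |]. intros _ q Hlt. apply Hq.
      simpl in Hlt. lra. }
  set (gauge := fun u v => proj1_sig (constructive_indefinite_description _ (Hg u v))).
  destruct (compactness_value_2d (- M) M (- M) M gauge) as [d Hd].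
  exists d. split; [apply cond_pos |]. intros q Hq.
  assert (HqM : Cmod q <= M) by auto.
  pose proof (re_le_Cmod q) as Hre. pose proof (im_le_Cmod q) as Him.
  apply Rle_trans with (2 := HqM) in Hre. apply Rle_trans with (2 := HqM) in Him.
  apply Rabs_le_between in Hre. apply Rabs_le_between in Him.
  destruct (NNPP _ (Hd (Re q) (Im q) Hre Him)) as [u [v (_ & _ & Hu & Hv & Hle)]].
  assert (Hlt : Cmod (q - (u, v)) < 2 * gauge u v).
  { eapply Rle_lt_trans; [apply Cmod_le_abs |].
    unfold Re, Im in *; simpl. unfold Rminus in Hu, Hv. lra. }
  unfold gauge in Hlt, Hle.
  destruct (constructive_indefinite_description _ (Hg u v)) as [e [He1 He2]]; simpl in *.
  destruct (classic (K (u, v))) as [H | H].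
  - exists (u, v). specialize (He1 H). pose proof (cond_pos e).
    split; [exact H |]. split; lra.
  - exfalso. exact (He2 H q Hlt Hq).
Qed.

Lemma compact_min (K : C -> Prop) (u : C -> R) :
  compact_set K -> (exists p, K p) ->
  (forall p, K p -> forall eps, 0 < eps -> exists d, 0 < d /\
     forall q, K q -> Cmod (q - p) < d -> u p - eps < u q) ->
  exists p, K p /\ forall q, K q -> u p <= u q.
Proof.
  intros HK [p0 Hp0] Hu.
  (* [compact_gauge] only returns a positive lower bound of radii, so the local lower bound
     [u p - 1] is encoded as the radius [exp (u p - 1)]; [ln d] then bounds [u] from below on all of
     [K]. *)
  assert (Hbelow : exists m, forall q, K q -> m <= u q).
  { assert (Hg : forall p, exists e, K p ->
      0 < e /\ forall q, K q -> Cmod (q - p) < e -> ln e <= u q).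
    { intros p. destruct (classic (K p)) as [H | H]; [| exists 0; tauto].
      destruct (Hu p H 1 Rlt_0_1) as [d [Hd Hq]].
      exists (Rmin d (exp (u p - 1))). intros _.
      assert (Hpos : 0 < Rmin d (exp (u p - 1))) by (apply Rmin_pos; [exact Hd | apply exp_pos]).
      split; [exact Hpos |]. intros q HKq Hlt.
      apply Rle_trans with (u p - 1).
      - eapply Rle_trans; [apply ln_le; [exact Hpos | apply Rmin_r] |].
        rewrite ln_exp. apply Rle_refl.
      - apply Rlt_le, Hq; [exact HKq |]. eapply Rlt_le_trans; [exact Hlt | apply Rmin_l]. }
    destruct (compact_gauge K (fun p => proj1_sig (constructive_indefinite_description _ (Hg p))) HK)
      as [d [Hd Hq]].
    - intros p HKp. now destruct (constructive_indefinite_description _ (Hg p)) as [e He]; apply He.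
    - exists (ln d). intros q HKq. destruct (Hq q HKq) as [p [HKp [Hlt Hle]]].
      destruct (constructive_indefinite_description _ (Hg p)) as [e He]; simpl in *.
      destruct (He HKp) as [He0 He1].
      apply Rle_trans with (ln e); [now apply ln_le | now apply He1]. }
  destruct Hbelow as [m Hm].
  destruct (completeness (fun r => exists q, K q /\ r = - u q)) as [s [Hs1 Hs2]].
  { exists (- m). intros r [q [Hq ->]]. specialize (Hm q Hq). lra. }
  { exists (- u p0), p0. auto. }
  apply NNPP. intros Hno.
  assert (Hlt : forall p, K p -> - s < u p).
  { intros p Hp. destruct (Rle_lt_dec (u p) (- s)) as [H | H]; [| exact H].
    exfalso. apply Hno. exists p. split; [exact Hp |]. intros q Hq.
    assert (- u q <= s) by (apply Hs1; exists q; auto). lra. }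
  (* The infimum is [- s]. If it is not attained, radii are taken at most half the gap [u p + s];
     the common bound [d] then gives [d - s <= u] on [K], against the choice of [s]. *)
  assert (Hg : forall p, exists e, K p ->
    0 < e /\ forall q, K q -> Cmod (q - p) < e -> e - s <= u q).
  { intros p. destruct (classic (K p)) as [H | H]; [| exists 0; tauto].
    specialize (Hlt p H).
    destruct (Hu p H ((u p + s) / 2)) as [d [Hd Hq]]; [lra |].
    exists (Rmin d ((u p + s) / 2)). intros _. split; [apply Rmin_pos; lra |].
    intros q HKq Hc. pose proof (Rmin_r d ((u p + s) / 2)). pose proof (Rmin_l d ((u p + s) / 2)).
    specialize (Hq q HKq). lra. }
  destruct (compact_gauge K (fun p => proj1_sig (constructive_indefinite_description _ (Hg p))) HK)
    as [d [Hd Hq]].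
  - intros p HKp. now destruct (constructive_indefinite_description _ (Hg p)) as [e He]; apply He.
  - assert (s <= s - d); [| lra].
    apply Hs2. intros r [q [HKq ->]].
    destruct (Hq q HKq) as [p [HKp [Hc Hle]]].
    destruct (constructive_indefinite_description _ (Hg p)) as [e He]; simpl in *.
    destruct (He HKp) as [He0 He1]. specialize (He1 q HKq Hc). lra.
Qed.

Lemma closed_disk_compact (p : C) (r : R) : compact_set (fun q => Cmod (q - p) <= r).
Proof.
  split.
  - exists (r + Cmod p). intros q Hq. pose proof (Cmod_triangle (q - p) p) as T.
    replace (q - p + p)%C with q in T by ring. lra.
  - intros q Hq. exists (Cmod (q - p) - r). split; [lra |]. intros w Hw Hle.
    pose proof (Cmod_triangle (w - p) (q - w)) as T.
    replace (w - p + (q - w))%C with (q - p)%C in T by ring. rewrite (Cmod_sub_sym q w) in T. lra.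
Qed.

Definition rectangle (a b c d : R) (p : C) : Prop := a <= Re p <= b /\ c <= Im p <= d.

Lemma rectangle_compact (a b c d : R) : compact_set (rectangle a b c d).
Proof.
  split.
  - exists (Rabs a + Rabs b + (Rabs c + Rabs d)). intros p [H1 H2].
    eapply Rle_trans; [apply Cmod_le_abs |].
    apply Rplus_le_compat; unfold Rabs in *; repeat destruct Rcase_abs; lra.
  - intros p Hp.
    assert (H : 0 < Rmax (Rmax (a - Re p) (Re p - b)) (Rmax (c - Im p) (Im p - d))).
    { apply Rnot_le_lt. intros H. apply Hp.
      pose proof (Rmax_l (Rmax (a - Re p) (Re p - b)) (Rmax (c - Im p) (Im p - d))).
      pose proof (Rmax_r (Rmax (a - Re p) (Re p - b)) (Rmax (c - Im p) (Im p - d))).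
      pose proof (Rmax_l (a - Re p) (Re p - b)). pose proof (Rmax_r (a - Re p) (Re p - b)).
      pose proof (Rmax_l (c - Im p) (Im p - d)). pose proof (Rmax_r (c - Im p) (Im p - d)).
      split; lra. }
    exists (Rmax (Rmax (a - Re p) (Re p - b)) (Rmax (c - Im p) (Im p - d))). split; [exact H |].
    intros q Hq [H1 H2].
    assert (Hr : Rabs (Re q - Re p) <= Cmod (q - p)).
    { replace (Re q - Re p) with (Re (q - p)%C) by (unfold Re; simpl; ring). apply re_le_Cmod. }
    assert (Hi : Rabs (Im q - Im p) <= Cmod (q - p)).
    { replace (Im q - Im p) with (Im (q - p)%C) by (unfold Im; simpl; ring). apply im_le_Cmod. }
    unfold Rmax, Rabs in *. repeat destruct Rle_dec; repeat destruct Rcase_abs; lra.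
Qed.

(** The first derivative vanishes at [t0]; if [g2] were negative it would be negative just to the
    right, and the mean value theorem would push [g] below its minimum. *)
Lemma local_min_second_derivative (g g1 : R -> R) (t0 g2 d : R) :
  0 < d ->
  (forall t, Rabs (t - t0) < d -> is_derive g t (g1 t)) ->
  is_derive g1 t0 g2 ->
  (forall t, Rabs (t - t0) < d -> g t0 <= g t) ->
  0 <= g2.
Proof.
  intros Hd Hg Hg1 Hmin. apply Rnot_lt_le. intros Hneg.
  assert (H0 : g1 t0 = 0).
  { assert (Hpt : derivable_pt g t0).
    { exists (g1 t0). apply is_derive_Reals, Hg. rewrite Rminus_diag, Rabs_R0. exact Hd. }
    rewrite <- (deriv_minimum g (t0 - d) (t0 + d) t0 Hpt); try lra.
    - symmetry. apply derive_pt_eq. apply is_derive_Reals, Hg.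
      rewrite Rminus_diag, Rabs_R0. exact Hd.
    - intros x Hx1 Hx2. apply Hmin. apply Rabs_def1; lra. }
  apply is_derive_Reals in Hg1.
  destruct (Hg1 (- g2 / 2)) as [e He]; [lra |].
  pose proof (cond_pos e) as Hep.
  set (h := Rmin (e / 2) (d / 2)).
  assert (Hh : 0 < h) by (apply Rmin_pos; lra).
  assert (Hhe : h <= e / 2) by apply Rmin_l. assert (Hhd : h <= d / 2) by apply Rmin_r.
  destruct (MVT_cor2 g g1 t0 (t0 + h)) as [c [Heq Hc]].
  - lra.
  - intros x Hx. apply is_derive_Reals, Hg. apply Rabs_def1; lra.
  - assert (Hge : g t0 <= g (t0 + h)) by (apply Hmin, Rabs_def1; lra).
    assert (Hlt : g1 c < 0).
    { specialize (He (c - t0)). replace (t0 + (c - t0)) with c in He by ring.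
      rewrite H0 in He. assert (Hq : Rabs ((g1 c - 0) / (c - t0) - g2) < - g2 / 2).
      { apply He; [lra |]. apply Rabs_def1; lra. }
      apply Rabs_def2 in Hq. destruct Hq as [Hq _]. rewrite Rminus_0_r in Hq.
      apply Rnot_le_lt. intros Hnn.
      assert (0 <= g1 c / (c - t0)) by (apply Rdiv_le_0_compat; lra). lra. }
    replace (t0 + h - t0) with h in Heq by ring. nra.
Qed.

(* The Laplacian of [Re W] vanishes, so that of [Re W + Q] is [2 * (alpha + beta)], which is
   nonnegative at a local minimum. *)
Lemma local_min_laplacian (W W1 : C -> C) (p w2 : C) (alpha beta d : R) :
  0 < d ->
  (forall q, Cmod (q - p) < d -> cderive W q (W1 q)) ->
  cderive W1 p w2 ->
  (forall a b, let Q := fun q : C => Re (W q) + alpha * (Re q - a) ^ 2 + beta * (Im q - b) ^ 2 in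
     (forall q, Cmod (q - p) < d -> Q p <= Q q) -> 0 <= alpha + beta).
Proof.
  intros Hd HW HW1 a b Q HQ.
  assert (Hx : forall t, Rabs (t - Re p) < d -> Cmod ((t, Im p) - p) < d).
  { intros t Ht. eapply Rle_lt_trans; [apply Cmod_le_abs |].
    unfold Re, Im in *; simpl. replace (snd p + - snd p) with 0 by ring.
    rewrite Rabs_R0, Rplus_0_r. exact Ht. }
  assert (Hy : forall t, Rabs (t - Im p) < d -> Cmod ((Re p, t) - p) < d).
  { intros t Ht. eapply Rle_lt_trans; [apply Cmod_le_abs |].
    unfold Re, Im in *; simpl. replace (fst p + - fst p) with 0 by ring.
    rewrite Rabs_R0, Rplus_0_l. exact Ht. }
  assert (H1 : 0 <= Re w2 + 2 * alpha).
  { apply (local_min_second_derivative (fun t => Q (t, Im p))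
             (fun t => Re (W1 (t, Im p)) + 2 * alpha * (t - a)) (Re p) _ d Hd).
    - intros t Ht. destruct (cderive_horizontal W (t, Im p) _ (HW _ (Hx t Ht))) as [D _].
      simpl in D. unfold Q. 
      assert (E : is_derive (fun t : R => alpha * (t - a) ^ 2 + beta * (Im p - b) ^ 2) t
                    (2 * alpha * (t - a))) by (auto_derive; [trivial | ring]).
      eapply is_derive_ext; [| exact (is_derive_plus _ _ _ _ _ D E)].
      intros s. unfold plus; simpl. ring.
    - destruct (cderive_horizontal W1 p _ HW1) as [D _].
      assert (E : is_derive (fun t : R => 2 * alpha * (t - a)) (Re p) (2 * alpha))
        by (auto_derive; [trivial | ring]).
      exact (is_derive_plus _ _ _ _ _ D E).
    - intros t Ht. specialize (HQ _ (Hx t Ht)). destruct p as [x y]. exact HQ. }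
  assert (H2 : 0 <= - Re w2 + 2 * beta).
  { apply (local_min_second_derivative (fun t => Q (Re p, t))
             (fun t => - Im (W1 (Re p, t)) + 2 * beta * (t - b)) (Im p) _ d Hd).
    - intros t Ht. destruct (cderive_vertical W (Re p, t) _ (HW _ (Hy t Ht))) as [D _].
      simpl in D. unfold Q.
      assert (E : is_derive (fun t : R => alpha * (Re p - a) ^ 2 + beta * (t - b) ^ 2) t
                    (2 * beta * (t - b))) by (auto_derive; [trivial | ring]).
      eapply is_derive_ext; [| exact (is_derive_plus _ _ _ _ _ D E)].
      intros s. unfold plus; simpl. ring.
    - destruct (cderive_vertical W1 p _ HW1) as [_ D].
      assert (E : is_derive (fun t : R => 2 * beta * (t - b)) (Im p) (2 * beta))
        by (auto_derive; [trivial | ring]).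
      exact (is_derive_plus _ _ _ _ _ (is_derive_opp _ _ _ D) E).
    - intros t Ht. specialize (HQ _ (Hy t Ht)). destruct p as [x y]. exact HQ. }
  lra.
Qed.

Lemma quadratic_increment (k a t0 t : R) :
  Rabs (t - t0) <= 1 ->
  - (Rabs k * (1 + 2 * Rabs (t0 - a)) * Rabs (t - t0)) <= k * (t - a) ^ 2 - k * (t0 - a) ^ 2.
Proof.
  intros H. replace (k * (t - a) ^ 2 - k * (t0 - a) ^ 2)
    with (k * (t - t0 + 2 * (t0 - a)) * (t - t0)) by ring.
  assert (B : Rabs (k * (t - t0 + 2 * (t0 - a)) * (t - t0))
              <= Rabs k * (1 + 2 * Rabs (t0 - a)) * Rabs (t - t0)).
  { rewrite !Rabs_mult. apply Rmult_le_compat_r; [apply Rabs_pos |].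
    apply Rmult_le_compat_l; [apply Rabs_pos |].
    eapply Rle_trans; [apply Rabs_triang |]. rewrite Rabs_mult, (Rabs_pos_eq 2); lra. }
  apply Rabs_le_between in B. lra.
Qed.

(** Only the lower half of continuity is stated, in the form that [compact_min] takes. *)
Lemma quadratic_perturbation_continuous (W : C -> C) (p l : C) (alpha beta a b : R) :
  cderive W p l ->
  let Q := fun q : C => Re (W q) + alpha * (Re q - a) ^ 2 + beta * (Im q - b) ^ 2 in
  forall eps, 0 < eps -> exists d, 0 < d /\ forall q, Cmod (q - p) < d -> Q p - eps < Q q.
Proof.
  intros HW Q eps He. destruct (cderive_lipschitz W p l HW) as [M [d [HM [Hd H]]]].
  set (N := M + Rabs alpha * (1 + 2 * Rabs (Re p - a)) + Rabs beta * (1 + 2 * Rabs (Im p - b))).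
  assert (HA : 0 <= Rabs alpha * (1 + 2 * Rabs (Re p - a))).
  { apply Rmult_le_pos; [apply Rabs_pos |]. pose proof (Rabs_pos (Re p - a)). lra. }
  assert (HB : 0 <= Rabs beta * (1 + 2 * Rabs (Im p - b))).
  { apply Rmult_le_pos; [apply Rabs_pos |]. pose proof (Rabs_pos (Im p - b)). lra. }
  assert (HN : 0 < N) by (unfold N; lra).
  exists (Rmin (Rmin d 1) (eps / N)). split.
  { repeat apply Rmin_pos; try lra. now apply Rdiv_lt_0_compat. }
  intros q Hq.
  assert (H1 : Cmod (q - p) < d).
  { eapply Rlt_le_trans; [exact Hq |]. eapply Rle_trans; apply Rmin_l. }
  assert (H2 : Cmod (q - p) < 1).
  { eapply Rlt_le_trans; [exact Hq |]. eapply Rle_trans; [apply Rmin_l | apply Rmin_r]. }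
  assert (H3 : N * Cmod (q - p) < eps).
  { replace eps with (N * (eps / N)) by (field; lra). apply Rmult_lt_compat_l; [exact HN |].
    eapply Rlt_le_trans; [exact Hq | apply Rmin_r]. }
  assert (Hr : Rabs (Re q - Re p) <= Cmod (q - p)).
  { replace (Re q - Re p) with (Re (q - p)%C) by (unfold Re; simpl; ring). apply re_le_Cmod. }
  assert (Hi : Rabs (Im q - Im p) <= Cmod (q - p)).
  { replace (Im q - Im p) with (Im (q - p)%C) by (unfold Im; simpl; ring). apply im_le_Cmod. }
  assert (HR : - (M * Cmod (q - p)) <= Re (W q) - Re (W p)).
  { replace (Re (W q) - Re (W p)) with (Re (W q - W p)%C) by (unfold Re; simpl; ring).
    pose proof (re_le_Cmod (W q - W p)%C) as T. specialize (H q H1).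
    apply Rle_trans with (2 := H) in T. apply Rabs_le_between in T. lra. }
  pose proof (quadratic_increment alpha a (Re p) (Re q)) as QA.
  pose proof (quadratic_increment beta b (Im p) (Im q)) as QB.
  assert (Rabs alpha * (1 + 2 * Rabs (Re p - a)) * Rabs (Re q - Re p)
          <= Rabs alpha * (1 + 2 * Rabs (Re p - a)) * Cmod (q - p))
    by (apply Rmult_le_compat_l; assumption).
  assert (Rabs beta * (1 + 2 * Rabs (Im p - b)) * Rabs (Im q - Im p)
          <= Rabs beta * (1 + 2 * Rabs (Im p - b)) * Cmod (q - p))
    by (apply Rmult_le_compat_l; assumption).
  unfold Q. unfold N in H3. lra.
Qed.

(** * Maximum principle and Schwarz lemma *)

(** The regularity that [local_min_laplacian] consumes. It is stable under the field operations, so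
    it passes to the quotients in the Schwarz argument. *)
Definition twice_derivable (f : C -> C) : Prop :=
  exists f1 : C -> C, forall z, disk z -> cderive f z (f1 z) /\ exists l, cderive f1 z l.

Lemma twice_derivable_const (c : C) : twice_derivable (fun _ => c).
Proof.
  exists (fun _ => 0%C). intros z _. split; [apply cderive_const |].
  exists 0%C. apply cderive_const.
Qed.

Lemma twice_derivable_id : twice_derivable (fun z => z).
Proof.
  exists (fun _ => 1%C). intros z _. split; [apply cderive_id |].
  exists 0%C. apply cderive_const.
Qed.

Lemma twice_derivable_plus (f g : C -> C) :
  twice_derivable f -> twice_derivable g -> twice_derivable (fun z => f z + g z)%C.
Proof.
  intros [f1 Hf] [g1 Hg]. exists (fun z => f1 z + g1 z)%C. intros z Hz.
  destruct (Hf z Hz) as [F1 [l F2]]. destruct (Hg z Hz) as [G1 [m G2]].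
  split; [now apply cderive_plus |]. exists (l + m)%C. now apply cderive_plus.
Qed.

Lemma twice_derivable_minus (f g : C -> C) :
  twice_derivable f -> twice_derivable g -> twice_derivable (fun z => f z - g z)%C.
Proof.
  intros [f1 Hf] [g1 Hg]. exists (fun z => f1 z - g1 z)%C. intros z Hz.
  destruct (Hf z Hz) as [F1 [l F2]]. destruct (Hg z Hz) as [G1 [m G2]].
  split; [now apply cderive_minus |]. exists (l - m)%C. now apply cderive_minus.
Qed.

Lemma twice_derivable_mult (f g : C -> C) :
  twice_derivable f -> twice_derivable g -> twice_derivable (fun z => f z * g z)%C.
Proof.
  intros [f1 Hf] [g1 Hg]. exists (fun z => f1 z * g z + f z * g1 z)%C. intros z Hz.
  destruct (Hf z Hz) as [F1 [l F2]]. destruct (Hg z Hz) as [G1 [m G2]].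
  split; [now apply cderive_mult |]. eexists.
  apply (cderive_plus (fun z => f1 z * g z)%C (fun z => f z * g1 z)%C);
    apply cderive_mult; eassumption.
Qed.

Lemma twice_derivable_div (f g : C -> C) :
  twice_derivable f -> twice_derivable g -> (forall z, disk z -> g z <> 0%C) ->
  twice_derivable (fun z => f z / g z)%C.
Proof.
  intros [f1 Hf] [g1 Hg] H0. exists (fun z => (f1 z * g z - f z * g1 z) / (g z * g z))%C.
  intros z Hz. destruct (Hf z Hz) as [F1 [l F2]]. destruct (Hg z Hz) as [G1 [m G2]].
  split; [apply cderive_div; auto |]. eexists.
  apply (cderive_div (fun z => f1 z * g z - f z * g1 z)%C (fun z => g z * g z)%C).
  - now apply Cmult_neq_0; apply H0.
  - apply (cderive_minus (fun z => f1 z * g z)%C (fun z => f z * g1 z)%C);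
      apply cderive_mult; eassumption.
  - apply cderive_mult; eassumption.
Qed.

Lemma max_principle (W : C -> C) (r M : R) :
  twice_derivable W -> 0 < r < 1 ->
  (forall z, Cmod z = r -> Re (W z) <= M) ->
  forall z, Cmod z <= r -> Re (W z) <= M.
Proof.
  intros [W1 HW] Hr Hb z Hz. apply le_epsilon. intros eps Heps.
  (* The term in [eps] makes [u] strictly superharmonic, which forces its minimum onto the circle;
     since [r < 1] the term changes the bound by at most [eps]. *)
  set (u := fun q => Re (- W q)%C + - eps * (Re q - 0) ^ 2 + 0 * (Im q - 0) ^ 2).
  assert (Hdisk : forall q, Cmod (q - 0) <= r -> disk q).
  { intros q Hq. unfold disk. replace (q - 0)%C with q in Hq by ring. lra. }
  destruct (compact_min (fun q => Cmod (q - 0) <= r) u) as [p [Hp Hmin]].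
  - apply closed_disk_compact.
  - exists 0%C. replace (0 - 0)%C with (RtoC 0) by ring. rewrite Cmod_0. lra.
  - intros p Hp e He. 
    destruct (quadratic_perturbation_continuous (fun q => - W q)%C p (- W1 p)%C (- eps) 0 0 0)
      with (eps := e) as [d [Hd H]]; [now apply cderive_opp, HW, Hdisk | exact He |].
    exists d. split; [exact Hd |]. intros q _. apply H.
  - destruct (Rle_lt_or_eq_dec _ _ Hp) as [Hlt | Heq].
    + exfalso. destruct (proj2 (HW p (Hdisk p Hp))) as [l Hl].
      assert (Hin : forall q, Cmod (q - p) < r - Cmod (p - 0) -> Cmod (q - 0) <= r).
      { intros q Hq. pose proof (Cmod_triangle (q - p) (p - 0)) as T.
        replace (q - p + (p - 0))%C with (q - 0)%C in T by ring. lra. }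
      pose proof (local_min_laplacian (fun q => - W q)%C (fun q => - W1 q)%C p (- l)%C
                    (- eps) 0 (r - Cmod (p - 0))) as L.
      assert (0 <= - eps + 0); [| lra].
      apply (L ltac:(lra)) with (a := 0) (b := 0).
      * intros q Hq. now apply cderive_opp, HW, Hdisk, Hin.
      * now apply cderive_opp.
      * intros q Hq. now apply Hmin, Hin.
    + replace (p - 0)%C with p in Heq by ring.
      assert (Hzz : Cmod (z - 0) <= r) by (replace (z - 0)%C with z by ring; exact Hz).
      specialize (Hmin z Hzz). specialize (Hb p Heq). unfold u in Hmin.
      pose proof (re_le_Cmod p) as HR. rewrite Heq in HR. apply Rabs_le_between in HR.
      assert (HRp : Re p ^ 2 <= 1) by nra. assert (HRz : 0 <= Re z ^ 2) by nra.
      assert (eps * Re p ^ 2 <= eps) by nra. assert (0 <= eps * Re z ^ 2) by nra.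
      unfold Re in *. simpl in *. lra.
Qed.

(** Schwarz's lemma with the division by [z] already performed: on [|w| = r] one has
    [|b w| <= 1 / r], the maximum principle carries this inside, and [r] can be taken close to 1. *)
Lemma weak_schwarz (b : C -> C) :
  twice_derivable b -> (forall z, disk z -> Cmod (z * b z) <= 1) ->
  forall z, disk z -> Cmod (b z) <= 1.
Proof.
  intros Hb H z Hz. apply Rnot_lt_le. intros Hgt.
  assert (Hi : / Cmod (b z) < 1) by (rewrite <- Rinv_1; apply Rinv_lt_contravar; lra).
  (* The midpoint of [1 / |b z|] and 1 is below 1 and makes [r * |b z| > 1]; the maximum keeps [z]
     inside the circle. *)
  set (r := Rmax (Cmod z) ((1 + / Cmod (b z)) / 2)).
  assert (Hr : r < 1) by (apply Rmax_lub_lt; [exact Hz | lra]).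
  assert (Hr2 : (1 + / Cmod (b z)) / 2 <= r) by apply Rmax_r.
  assert (Hip : 0 < / Cmod (b z)) by (apply Rinv_0_lt_compat; lra).
  assert (Hzr : Cmod z <= r) by apply Rmax_l.
  (* A rotation with [c * b z = |b z|], so that a bound on real parts bounds the modulus at [z]. *)
  set (c := (Cconj (b z) / RtoC (Cmod (b z)))%C).
  assert (Hne : RtoC (Cmod (b z)) <> 0%C).
  { intros E. apply (f_equal Re) in E. simpl in E. lra. }
  assert (Hc : Cmod c = 1).
  { unfold c. rewrite Cmod_div, Cmod_conj, Cmod_R, Rabs_pos_eq by (exact Hne || lra).
    field. lra. }
  assert (HM : Re (c * b z)%C <= / r).
  { apply (max_principle (fun z => c * b z)%C r); try lra.
    - apply twice_derivable_mult; [apply twice_derivable_const | exact Hb].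
    - intros w Hw. eapply Rle_trans; [apply Rle_abs |].
      eapply Rle_trans; [apply re_le_Cmod |]. rewrite Cmod_mult, Hc, Rmult_1_l.
      assert (Hd : disk w) by (unfold disk; lra). specialize (H w Hd).
      rewrite Cmod_mult, Hw in H. apply (Rmult_le_reg_l r); [lra |].
      rewrite Rinv_r; lra. }
  assert (Hcb : (c * b z)%C = RtoC (Cmod (b z))).
  { unfold c. replace (Cconj (b z) / RtoC (Cmod (b z)) * b z)%C
      with (b z * Cconj (b z) / RtoC (Cmod (b z)))%C by (field; exact Hne).
    rewrite <- Cmod2_conj, RtoC_pow. field. exact Hne. }
  rewrite Hcb in HM. simpl in HM.
  assert (r * Cmod (b z) <= 1).
  { replace 1 with (r * / r) by (apply Rinv_r; lra). apply Rmult_le_compat_l; lra. }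
  assert ((1 + / Cmod (b z)) / 2 * Cmod (b z) <= 1) by nra.
  assert (/ Cmod (b z) * Cmod (b z) = 1) by (apply Rinv_l; lra). nra.
Qed.

(** For [a > 0], the points at least as close to 0 as to [- a] form the half-plane
    [Re w >= - a / 2]. *)
Lemma Cmod_le_shift (w : C) (a : R) : 0 <= a -> - a <= 2 * Re w -> Cmod w <= Cmod (w + RtoC a)%C.
Proof.
  intros Ha Hw. unfold Cmod. apply sqrt_le_1_alt. unfold Re in Hw. simpl. nra.
Qed.

(* With [Phi z = z * phi z], [e * Phi] maps the disk into [Re w > -1/2] with derivative of modulus
   1 at 0, which is the extremal case of Schwarz' lemma for [e * Phi / (1 + e * Phi)]. *)
Lemma half_plane_extremal (phi psi : C -> C) (e : C) :
  Cmod e = 1 ->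
  twice_derivable phi -> twice_derivable psi ->
  (forall z, disk z -> phi z = 1 + z * psi z)%C ->
  (forall z, disk z -> - (1 / 2) < Re (e * (z * phi z))%C) ->
  forall z, disk z -> phi z = (1 + e * (z * phi z))%C.
Proof.
  intros He Hphi Hpsi Heq Hre z Hz.
  set (D := fun z => (1 + e * (z * phi z))%C).
  assert (HD : forall z, disk z -> D z <> 0%C).
  { intros w Hw E. apply (f_equal Re) in E. specialize (Hre w Hw).
    unfold D in E. rewrite re_plus, !re_RtoC in E. lra. }
  assert (HtD : twice_derivable D).
  { apply twice_derivable_plus; [apply twice_derivable_const |].
    apply twice_derivable_mult; [apply twice_derivable_const |].
    apply twice_derivable_mult; [apply twice_derivable_id | exact Hphi]. }
  set (q := fun z => (phi z / D z)%C).
  assert (Hq : forall z, disk z -> Cmod (q z) <= 1).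
  { apply weak_schwarz; [apply twice_derivable_div; auto |].
    intros w Hw. unfold q. replace (w * (phi w / D w))%C with ((w * phi w) / D w)%C
      by (field; now apply HD).
    rewrite Cmod_div by now apply HD.
    assert (0 < Cmod (D w)) by now apply Cmod_gt_0, HD.
    apply (Rmult_le_reg_r (Cmod (D w))); [assumption |].
    unfold Rdiv. rewrite Rmult_assoc, Rinv_l, Rmult_1_r, Rmult_1_l by lra.
    rewrite <- (Rmult_1_l (Cmod (w * phi w))), <- He, <- Cmod_mult.
    unfold D. rewrite Cplus_comm. apply Cmod_le_shift; [lra |].
    specialize (Hre w Hw). lra. }
  (* Since [q 0 = 1], the function [1 - q] is divisible by [z]. The quotient is written with [psi],
     which makes it visibly differentiable at 0. *)
  set (s := fun z => ((e * phi z - psi z) / D z)%C).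
  assert (Hts : twice_derivable s).
  { apply twice_derivable_div; auto. apply twice_derivable_minus; [| exact Hpsi].
    apply twice_derivable_mult; [apply twice_derivable_const | exact Hphi]. }
  assert (Hs : forall z, disk z -> (z * s z)%C = (1 - q z)%C).
  { intros w Hw. unfold s, q.
    replace (1 - phi w / D w)%C with ((D w - phi w) / D w)%C by (field; now apply HD).
    replace (w * ((e * phi w - psi w) / D w))%C with ((e * (w * phi w) - w * psi w) / D w)%C
      by (field; now apply HD).
    f_equal. unfold D. rewrite (Heq w Hw) at 3. ring. }
  assert (Hres : forall z, disk z -> 0 <= Re (z * s z)%C).
  { intros w Hw. rewrite Hs by assumption. pose proof (re_le_Cmod (q w)) as H1.
    specialize (Hq w Hw). pose proof (Rle_abs (Re (q w))).
    unfold Cminus. rewrite re_plus, re_opp, re_RtoC. lra. }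
  (* This replaces the equality case of the maximum principle. As [Re (z * s z) >= 0], the function
     [z * s / (z * s + 2 * A)] is bounded by 1, and [weak_schwarz] removes the factor [z]. Letting
     [A] tend to 0 gives [|s z| <= |z| |s z|], hence [s z = 0]. *)
  assert (Hbound : forall A, 0 < A -> Cmod (s z) <= Cmod (z * s z) + 2 * A).
  { intros A HA.
    assert (Hn : forall z, disk z -> (z * s z + RtoC (2 * A))%C <> 0%C).
    { intros w Hw E. apply (f_equal Re) in E. specialize (Hres w Hw).
      rewrite re_plus, !re_RtoC in E. lra. }
    assert (Hb : Cmod (s z / (z * s z + RtoC (2 * A)))%C <= 1).
    { apply (weak_schwarz (fun z => s z / (z * s z + RtoC (2 * A)))%C); [| | exact Hz].
      - apply twice_derivable_div; auto. apply twice_derivable_plus; [| apply twice_derivable_const].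
        apply twice_derivable_mult; [apply twice_derivable_id | exact Hts].
      - intros w Hw. specialize (Hn w Hw).
        replace (w * (s w / (w * s w + RtoC (2 * A))))%C
          with ((w * s w) / (w * s w + RtoC (2 * A)))%C by (field; exact Hn).
        rewrite Cmod_div by exact Hn.
        assert (0 < Cmod (w * s w + RtoC (2 * A))%C) by now apply Cmod_gt_0.
        apply (Rmult_le_reg_r (Cmod (w * s w + RtoC (2 * A))%C)); [assumption |].
        unfold Rdiv. rewrite Rmult_assoc, Rinv_l, Rmult_1_r, Rmult_1_l by lra.
        apply Cmod_le_shift; [lra |]. specialize (Hres w Hw). lra. }
    rewrite Cmod_div in Hb by now apply Hn.
    assert (0 < Cmod (z * s z + RtoC (2 * A))%C) by now apply Cmod_gt_0, Hn.
    apply (Rmult_le_compat_r (Cmod (z * s z + RtoC (2 * A))%C)) in Hb; [| lra].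
    unfold Rdiv in Hb. rewrite Rmult_assoc, Rinv_l, Rmult_1_r, Rmult_1_l in Hb by lra.
    eapply Rle_trans; [exact Hb |]. eapply Rle_trans; [apply Cmod_triangle |].
    rewrite Cmod_R, Rabs_pos_eq; lra. }
  assert (Hs0 : s z = 0%C).
  { apply Cmod_eq_0. apply Rle_antisym; [| apply Cmod_ge_0].
    apply Rnot_lt_le. intros Hpos. rewrite Cmod_mult in Hbound. unfold disk in Hz.
    specialize (Hbound ((1 - Cmod z) * Cmod (s z) / 4)). 
    assert (0 < (1 - Cmod z) * Cmod (s z)) by (apply Rmult_lt_0_compat; lra). lra. }
  specialize (Hs z Hz). rewrite Hs0 in Hs.
  assert (Hq1 : q z = 1%C).
  { replace (q z) with (1 - (1 - q z))%C by ring. rewrite <- Hs. ring. }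
  transitivity (q z * D z)%C; [unfold q; field; now apply HD |].
  rewrite Hq1. unfold D. ring.
Qed.

(** * Complex power series *)

Definition cseries (t : nat -> C) (l : C) : Prop :=
  is_series (K := C_AbsRing) (V := C_NormedModule) t l.

Lemma cseries_unique (t : nat -> C) (l m : C) : cseries t l -> cseries t m -> l = m.
Proof.
  exact (filterlim_locally_unique (K := C_AbsRing) (V := C_NormedModule) (F := eventually) _ l m).
Qed.

Lemma cseries_ext (s t : nat -> C) (l m : C) :
  (forall n, s n = t n) -> l = m -> cseries s l -> cseries t m.
Proof. intros H <-. now apply (is_series_ext (K := C_AbsRing) (V := C_NormedModule)). Qed.

Lemma cseries_plus (s t : nat -> C) (l m : C) :
  cseries s l -> cseries t m -> cseries (fun n => s n + t n)%C (l + m)%C.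
Proof. exact (is_series_plus (K := C_AbsRing) (V := C_NormedModule) s t l m). Qed.

Lemma cseries_scal (c : C) (t : nat -> C) (l : C) :
  cseries t l -> cseries (fun n => c * t n)%C (c * l)%C.
Proof. exact (is_series_scal (K := C_AbsRing) (V := C_NormedModule) c t l). Qed.

Lemma cseries_tail (t : nat -> C) (l : C) :
  cseries t l -> cseries (fun n => t (S n)) (l - t 0%nat)%C.
Proof.
  intros H. apply (is_series_incr_1 (K := C_AbsRing) (V := C_NormedModule)).
  eapply cseries_ext; [reflexivity | | exact H]. unfold plus; simpl. ring.
Qed.

Lemma cseries_cons (t : nat -> C) (l : C) :
  cseries (fun n => t (S n)) l -> cseries t (l + t 0%nat)%C.
Proof.
  intros H. apply (is_series_decr_1 (K := C_AbsRing) (V := C_NormedModule)).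
  eapply cseries_ext; [reflexivity | | exact H]. unfold plus, opp; simpl. ring.
Qed.

Lemma cseries_norm_le (t : nat -> C) (l : C) (b : nat -> R) (s : R) :
  cseries t l -> (forall n, Cmod (t n) <= b n) -> is_series b s -> Cmod l <= s.
Proof.
  intros Ht Hb Hs.
  apply (is_lim_seq_le (fun n => Cmod (sum_n (G := C_NormedModule) t n)) (sum_n b) (Cmod l) s).
  - intros n. eapply Rle_trans.
    + exact (norm_sum_n_m (K := C_AbsRing) (V := C_NormedModule) t 0 n).
    + now apply sum_n_m_le.
  - eapply filterlim_comp; [exact Ht |].
    exact (filterlim_norm (K := C_AbsRing) (V := C_NormedModule) l).
  - exact Hs.
Qed.

Lemma cseries_exists (t : nat -> C) (b : nat -> R) :
  (forall n, Cmod (t n) <= b n) -> ex_series b -> exists l, cseries t l.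
Proof. exact (ex_series_le (K := C_AbsRing) (V := C_CompleteNormedModule) t b). Qed.

Lemma cseries_bounded (t : nat -> C) (l : C) : cseries t l -> exists M, forall n, Cmod (t n) <= M.
Proof.
  intros H. destruct (filterlim_bounded (K := C_AbsRing) (V := C_NormedModule)
                        (sum_n (G := C_NormedModule) t)) as [M HM].
  { exists l. exact H. }
  change (forall n, Cmod (sum_n (G := C_NormedModule) t n) <= M) in HM.
  exists (M + M). intros n. destruct n as [| n].
  - specialize (HM 0%nat). rewrite sum_O in HM. pose proof (Cmod_ge_0 (t 0%nat)). lra.
  - pose proof (HM (S n)) as H1. pose proof (HM n) as H2. rewrite sum_Sn in H1.
    set (u := sum_n (G := C_NormedModule) t n) in *.
    change (Cmod (u + t (S n))%C <= M) in H1. change (Cmod u <= M) in H2.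
    pose proof (Cmod_triangle (u + t (S n)) (- u)) as T. rewrite Cmod_opp in T.
    replace (u + t (S n) + - u)%C with (t (S n)) in T by ring. lra.
Qed.

Lemma pow_n_Cpow (z : C) (n : nat) : pow_n (K := C_AbsRing) z n = Cpow z n.
Proof. induction n as [| n IH]; [reflexivity |]. simpl. now rewrite IH. Qed.

Lemma power_series_iff (a : nat -> C) (h : C -> C) :
  power_series a h <-> forall z, disk z -> cseries (fun n => Cpow z n * a n)%C (h z).
Proof.
  split; intros H z Hz; specialize (H z Hz);
    (eapply cseries_ext; [| reflexivity | exact H]); intros n; now rewrite <- pow_n_Cpow.
Qed.

(** Stated for the moduli, so that facts about real power series give the radius of the derived and
    of the shifted series. *)
Definition radius_ge_1 (b : nat -> C) : Prop := Rbar_le 1 (CV_radius (fun n => Cmod (b n))).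

Lemma power_series_radius (a : nat -> C) (h : C -> C) : power_series a h -> radius_ge_1 a.
Proof.
  rewrite power_series_iff. intros H.
  assert (Hr : forall r, 0 <= r < 1 -> Rbar_le r (CV_radius (fun n => Cmod (a n)))).
  { intros r Hr. destruct (CV_radius_bounded (fun n => Cmod (a n))) as [Hub _].
    apply Hub. assert (Hd : disk (RtoC r)) by (unfold disk; rewrite Cmod_R, Rabs_pos_eq; lra).
    destruct (cseries_bounded _ _ (H _ Hd)) as [M HM].
    exists M. intros n. specialize (HM n).
    rewrite Cmod_mult, Cmod_pow, Cmod_R, Rabs_pos_eq in HM by lra.
    rewrite Rabs_pos_eq; [lra |]. apply Rmult_le_pos; [apply Cmod_ge_0 | apply pow_le; lra]. }
  unfold radius_ge_1. destruct (CV_radius (fun n => Cmod (a n))) as [c | |].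
  - simpl. apply Rnot_lt_le. intros Hlt. 
    assert (H0 : 0 <= c) by exact (Hr 0 ltac:(lra)).
    assert (Hm : (1 + c) / 2 <= c) by (apply (Hr ((1 + c) / 2)); lra). lra.
  - exact I.
  - exact (Hr 0 ltac:(lra)).
Qed.

Lemma radius_ex_series (b : nat -> C) (r : R) :
  radius_ge_1 b -> 0 <= r < 1 -> ex_series (fun n => Cmod (b n) * r ^ n).
Proof.
  intros Hb Hr. assert (H : Rbar_lt (Rabs r) (CV_radius (fun n => Cmod (b n)))).
  { apply Rbar_lt_le_trans with 1; [simpl; rewrite Rabs_pos_eq; lra | exact Hb]. }
  eapply ex_series_ext; [| exact (CV_disk_inside _ _ H)].
  intros n. apply Rabs_pos_eq. apply Rmult_le_pos; [apply Cmod_ge_0 | apply pow_le; lra].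
Qed.

Lemma radius_power_series (b : nat -> C) : radius_ge_1 b -> exists h, power_series b h.
Proof.
  intros Hb.
  assert (H : forall z, exists l, disk z -> cseries (fun n => Cpow z n * b n)%C l).
  { intros z. destruct (classic (disk z)) as [Hz | Hz]; [| exists 0%C; tauto].
    destruct (cseries_exists (fun n => Cpow z n * b n)%C (fun n => Cmod (b n) * Cmod z ^ n))
      as [l Hl].
    - intros n. rewrite Cmod_mult, Cmod_pow. lra.
    - apply radius_ex_series; [exact Hb |]. split; [apply Cmod_ge_0 | exact Hz].
    - exists l. auto. }
  exists (fun z => proj1_sig (constructive_indefinite_description _ (H z))).
  apply power_series_iff. intros z Hz.
  destruct (constructive_indefinite_description _ (H z)) as [l Hl]. now apply Hl.
Qed.

Definition derived (a : nat -> C) (n : nat) : C := (RtoC (INR (S n)) * a (S n))%C.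

Lemma derived_radius (a : nat -> C) : radius_ge_1 a -> radius_ge_1 (derived a).
Proof.
  unfold radius_ge_1. intros H. rewrite <- CV_radius_derive in H.
  erewrite CV_radius_ext; [exact H |]. intros n. unfold derived, PS_derive.
  rewrite Cmod_mult, Cmod_R, Rabs_pos_eq; [reflexivity | apply pos_INR].
Qed.

Lemma tail_radius (a : nat -> C) : radius_ge_1 a -> radius_ge_1 (fun n => a (S n)).
Proof.
  unfold radius_ge_1. intros H. rewrite <- CV_radius_decr_1 in H. exact H.
Qed.

(** Taylor remainder of the power [n = m + 2], with the factor [n (n - 1) r^(n - 2)] of the twice
    derived series. If [D] is the remainder for [n], the next one is
    [w * D + n z^(n - 1) (w - z)^2]. *)
Lemma second_difference_bound (z w : C) (r : R) (m : nat) :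
  Cmod z <= r -> Cmod w <= r ->
  Cmod (Cpow w (S (S m)) - Cpow z (S (S m)) - (w - z) * (RtoC (INR (S (S m))) * Cpow z (S m)))%C
  <= INR (S (S m)) * INR (S m) * r ^ m * Cmod (w - z) ^ 2.
Proof.
  intros Hz Hw. assert (Hr : 0 <= r) by (pose proof (Cmod_ge_0 z); lra).
  induction m as [| m IH].
  - replace (Cpow w 2 - Cpow z 2 - (w - z) * (RtoC (INR 2) * Cpow z 1))%C
      with ((w - z) * (w - z))%C by (simpl INR; rewrite RtoC_plus; simpl; ring).
    rewrite Cmod_mult. simpl. pose proof (Cmod_ge_0 (w - z)). nra.
  - set (D := (Cpow w (S (S m)) - Cpow z (S (S m))
               - (w - z) * (RtoC (INR (S (S m))) * Cpow z (S m)))%C) in *.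
    replace (Cpow w (S (S (S m))) - Cpow z (S (S (S m)))
             - (w - z) * (RtoC (INR (S (S (S m)))) * Cpow z (S (S m))))%C
      with (w * D + RtoC (INR (S (S m))) * Cpow z (S m) * ((w - z) * (w - z)))%C.
    2: { unfold D. rewrite (S_INR (S (S m))), RtoC_plus. simpl Cpow. ring. }
    eapply Rle_trans; [apply Cmod_triangle |]. rewrite !Cmod_mult, Cmod_pow, Cmod_R.
    rewrite (Rabs_pos_eq (INR (S (S m)))) by apply pos_INR.
    assert (Hp : 0 <= r ^ m) by now apply pow_le.
    assert (Hk : 0 <= Cmod (w - z) ^ 2) by (apply pow_le, Cmod_ge_0).
    assert (H1 : Cmod w * Cmod D <= r * (INR (S (S m)) * INR (S m) * r ^ m * Cmod (w - z) ^ 2)).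
    { apply Rmult_le_compat; try apply Cmod_ge_0; assumption. }
    assert (H2 : Cmod z ^ S m <= r ^ S m) by (apply pow_incr; split; [apply Cmod_ge_0 | exact Hz]).
    assert (H3 : INR (S (S m)) * Cmod z ^ S m * (Cmod (w - z) * Cmod (w - z))
                 <= INR (S (S m)) * r ^ S m * Cmod (w - z) ^ 2).
    { replace (Cmod (w - z) * Cmod (w - z)) with (Cmod (w - z) ^ 2) by ring.
      apply Rmult_le_compat_r; [exact Hk |]. apply Rmult_le_compat_l; [apply pos_INR | exact H2]. }
    eapply Rle_trans; [apply Rplus_le_compat; [exact H1 | exact H3] |].
    rewrite (S_INR (S (S m))). set (N := INR (S (S m))) in *.
    assert (HN : INR (S m) = N - 1) by (unfold N; rewrite (S_INR (S m)); ring).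
    assert (HN0 : 0 <= N) by apply pos_INR.
    rewrite HN. simpl (r ^ S m).
    assert (0 <= N * (r * r ^ m) * Cmod (w - z) ^ 2).
    { apply Rmult_le_pos; [| exact Hk]. apply Rmult_le_pos; [exact HN0 |].
      now apply Rmult_le_pos. }
    nra.
Qed.

Lemma power_series_derive (a : nat -> C) (h : C -> C) :
  power_series a h ->
  exists h1, power_series (derived a) h1 /\ forall z, disk z -> cderive h z (h1 z).
Proof.
  intros Hh. pose proof (power_series_radius a h Hh) as Ha.
  destruct (radius_power_series _ (derived_radius a Ha)) as [h1 Hh1].
  exists h1. split; [exact Hh1 |]. intros z Hz.
  rewrite power_series_iff in Hh, Hh1.
  (* Halfway between [|z|] and 1: a neighbourhood of [z] lies in [|w| <= r], and the twice derived
     series still converges absolutely at [r]. Its sum [s] is the constant of the quadratic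
     remainder. *)
  set (r := (1 + Cmod z) / 2). unfold disk in Hz.
  assert (Hr : Cmod z < r < 1) by (unfold r; lra).
  assert (Hr0 : 0 <= r) by (pose proof (Cmod_ge_0 z); lra).
  destruct (radius_ex_series (derived (derived a)) r) as [s Hs];
    [now apply derived_radius, derived_radius | lra |].
  assert (Hkey : forall w, Cmod w <= r ->
    Cmod (h w - h z - (w - z) * h1 z)%C <= s * Cmod (w - z) ^ 2).
  { intros w Hw. assert (Hwd : disk w) by (unfold disk; lra).
    pose proof (Hh w Hwd) as S1. pose proof (Hh z Hz) as S2. pose proof (Hh1 z Hz) as S3.
    (* The derived series moved up by one index, with 0 in front, so that it can be subtracted term
       by term. The terms 0 and 1 of the combination [u] vanish, which is why two tails are taken
       below. *)
    set (t := fun n => match n return C with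
                       | O => RtoC 0
                       | S m => (Cpow z m * derived a m)%C end).
    assert (S4 : cseries t (h1 z)).
    { eapply cseries_ext; [reflexivity | | apply cseries_cons]; [| exact S3]. simpl. ring. }
    set (u := fun n => (Cpow w n * a n + (- (1)) * (Cpow z n * a n) + - (w - z) * t n)%C).
    assert (S5 : cseries u (h w - h z - (w - z) * h1 z)%C).
    { eapply cseries_ext; [reflexivity | |
        apply cseries_plus; [apply cseries_plus; [exact S1 | apply cseries_scal; exact S2] |
                             apply cseries_scal; exact S4]].
      ring. }
    apply cseries_tail, cseries_tail in S5.
    apply (cseries_norm_le _ _ (fun n => Cmod (derived (derived a) n) * r ^ n * Cmod (w - z) ^ 2)
             (s * Cmod (w - z) ^ 2)) in S5.
    - replace (h w - h z - (w - z) * h1 z - u 0%nat - u 1%nat)%C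
        with (h w - h z - (w - z) * h1 z)%C in S5; [exact S5 |].
      unfold u, t, derived. simpl. ring.
    - intros n. unfold u, t.
      replace (Cpow w (S (S n)) * a (S (S n)) + - (1) * (Cpow z (S (S n)) * a (S (S n)))
               + - (w - z) * (Cpow z (S n) * derived a (S n)))%C
        with ((Cpow w (S (S n)) - Cpow z (S (S n))
               - (w - z) * (RtoC (INR (S (S n))) * Cpow z (S n))) * a (S (S n)))%C
        by (unfold derived; ring).
      rewrite Cmod_mult. unfold derived. rewrite !Cmod_mult, !Cmod_R, !Rabs_pos_eq by apply pos_INR.
      replace (INR (S n) * (INR (S (S n)) * Cmod (a (S (S n)))) * r ^ n * Cmod (w - z) ^ 2)
        with (INR (S (S n)) * INR (S n) * r ^ n * Cmod (w - z) ^ 2 * Cmod (a (S (S n)))) by ring.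
      apply Rmult_le_compat_r; [apply Cmod_ge_0 |]. apply second_difference_bound; lra.
    - eapply is_series_ext; [| apply is_series_scal_r; exact Hs]. reflexivity. }
  apply cderive_eps. intros eps He.
  assert (Hs0 : s <= Rabs s) by apply Rle_abs. assert (0 <= Rabs s) by apply Rabs_pos.
  exists (Rmin (r - Cmod z) (eps / (Rabs s + 1))). split.
  { apply Rmin_pos; [lra |]. apply Rdiv_lt_0_compat; lra. }
  intros w Hw. eapply Rle_trans; [apply Hkey |].
  - assert (H1 : Cmod (w - z) < r - Cmod z) by (eapply Rlt_le_trans; [exact Hw | apply Rmin_l]).
    pose proof (Cmod_triangle (w - z) z) as T. replace (w - z + z)%C with w in T by ring. lra.
  - assert (H2 : Cmod (w - z) < eps / (Rabs s + 1)) by (eapply Rlt_le_trans; [exact Hw | apply Rmin_r]).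
    apply (Rmult_lt_compat_l (Rabs s + 1)) in H2; [| lra].
    replace ((Rabs s + 1) * (eps / (Rabs s + 1))) with eps in H2 by (field; lra).
    pose proof (Cmod_ge_0 (w - z)). 
    assert (s * Cmod (w - z) ^ 2 <= Rabs s * Cmod (w - z) ^ 2) by nra. nra.
Qed.

Lemma disk_near (z : C) : disk z -> exists d, 0 < d /\ forall q, Cmod (q - z) < d -> disk q.
Proof.
  unfold disk. intros Hz. exists (1 - Cmod z). split; [lra |]. intros q Hq.
  pose proof (Cmod_triangle (q - z) z) as T. replace (q - z + z)%C with q in T by ring. lra.
Qed.

Lemma power_series_ext (a b : nat -> C) (h k : C -> C) :
  (forall n, a n = b n) -> (forall z, disk z -> h z = k z) -> power_series a h -> power_series b k.
Proof.
  rewrite !power_series_iff. intros Hab Hhk H z Hz.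
  eapply cseries_ext; [| exact (Hhk z Hz) | exact (H z Hz)]. intros n. simpl. now rewrite Hab.
Qed.

Lemma power_series_plus (a b : nat -> C) (h k : C -> C) :
  power_series a h -> power_series b k ->
  power_series (fun n => a n + b n)%C (fun z => h z + k z)%C.
Proof.
  rewrite !power_series_iff. intros Ha Hb z Hz.
  eapply cseries_ext; [| reflexivity | exact (cseries_plus _ _ _ _ (Ha z Hz) (Hb z Hz))].
  intros n. simpl. ring.
Qed.

Lemma power_series_scal (c : C) (a : nat -> C) (h : C -> C) :
  power_series a h -> power_series (fun n => c * a n)%C (fun z => c * h z)%C.
Proof.
  rewrite !power_series_iff. intros Ha z Hz.
  eapply cseries_ext; [| reflexivity | exact (cseries_scal c _ _ (Ha z Hz))].
  intros n. simpl. ring.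
Qed.

Lemma power_series_rotate (e : C) (a : nat -> C) (h : C -> C) :
  Cmod e = 1 -> power_series a h -> power_series (fun n => Cpow e n * a n)%C (fun z => h (e * z)%C).
Proof.
  rewrite !power_series_iff. intros He Ha z Hz.
  assert (Hd : disk (e * z)%C) by (unfold disk; rewrite Cmod_mult, He, Rmult_1_l; exact Hz).
  eapply cseries_ext; [| reflexivity | exact (Ha _ Hd)].
  intros n. simpl. rewrite Cpow_mult_l. ring.
Qed.

Lemma disk_0 : disk 0%C.
Proof. unfold disk. rewrite Cmod_0. lra. Qed.

Lemma power_series_at_0 (a : nat -> C) (h : C -> C) : power_series a h -> h 0%C = a 0%nat.
Proof.
  rewrite power_series_iff. intros Ha.
  pose proof (cseries_tail _ _ (Ha _ disk_0)) as H.
  (* All terms of the tail vanish at 0, so the tail is termwise equal to its own multiple by 0;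
     uniqueness of the sum makes it 0. *)
  assert (H0 : cseries (fun n => 0 * (Cpow 0 (S n) * a (S n)))%C (0 * (h 0 - Cpow 0 0 * a 0%nat))%C)
    by now apply cseries_scal.
  assert (E : (h 0 - Cpow 0 0 * a 0%nat)%C = (0 * (h 0 - Cpow 0 0 * a 0%nat))%C).
  { apply (cseries_unique _ _ _ H). eapply cseries_ext; [| reflexivity | exact H0].
    intros n. simpl. ring. }
  replace (h 0%C) with ((h 0 - Cpow 0 0 * a 0%nat) + a 0%nat)%C by (simpl; ring).
  rewrite E. ring.
Qed.

(** Division by [z] on coefficients. Applied twice, it supplies the [phi] and [psi] of
    [half_plane_extremal]. *)
Lemma power_series_tail (a : nat -> C) (h : C -> C) :
  power_series a h ->
  exists k, power_series (fun n => a (S n)) k /\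
    forall z, disk z -> (h z = a 0%nat + z * k z)%C.
Proof.
  intros Ha. destruct (radius_power_series _ (tail_radius a (power_series_radius a h Ha))) as [k Hk].
  exists k. split; [exact Hk |]. intros z Hz. rewrite power_series_iff in Ha, Hk.
  apply (cseries_unique _ _ _ (Ha z Hz)).
  eapply cseries_ext; [reflexivity | | apply cseries_cons].
  2: { eapply cseries_ext; [| reflexivity | exact (cseries_scal z _ _ (Hk z Hz))].
       intros n. simpl. ring. }
  simpl. ring.
Qed.

Lemma derived_eq_0 (a : nat -> C) (n : nat) : derived a n = 0%C -> a (S n) = 0%C.
Proof.
  unfold derived. intros E. destruct (Ceq_dec (a (S n)) 0%C) as [H | H]; [exact H |].
  exfalso. revert E. apply Cmult_neq_0; [| exact H].
  intros E. apply (f_equal Re) in E. rewrite !re_RtoC in E. revert E.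
  apply not_0_INR. lia.
Qed.

Lemma power_series_zero (a : nat -> C) : power_series a (fun _ => 0%C) -> forall n, a n = 0%C.
Proof.
  intros Ha n. revert a Ha. induction n as [| n IH]; intros a Ha.
  - symmetry. exact (power_series_at_0 _ _ Ha).
  - destruct (power_series_derive _ _ Ha) as [h1 [H1 Hd]].
    assert (E : derived a n = 0%C).
    { apply IH. eapply power_series_ext; [reflexivity | | exact H1].
      intros z Hz. apply (cderive_unique (fun _ => 0%C) z); [now apply Hd | apply cderive_const]. }
    now apply derived_eq_0.
Qed.

Lemma power_series_twice_derivable (a : nat -> C) (h : C -> C) :
  power_series a h -> twice_derivable h.
Proof.
  intros H. destruct (power_series_derive _ _ H) as [h1 [H1 D1]].
  destruct (power_series_derive _ _ H1) as [h2 [H2 D2]].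
  exists h1. intros z Hz. split; [auto | exists (h2 z); auto].
Qed.

Lemma power_series_shift (a : nat -> C) (h : C -> C) :
  power_series a h ->
  power_series (fun n => match n return C with O => RtoC 0 | S m => a m end) (fun z => z * h z)%C.
Proof.
  rewrite !power_series_iff. intros Ha z Hz.
  eapply cseries_ext; [reflexivity | | apply cseries_cons].
  2: { eapply cseries_ext; [| reflexivity | exact (cseries_scal z _ _ (Ha z Hz))].
       intros n. simpl. ring. }
  simpl. ring.
Qed.

Lemma power_series_constant (a : nat -> C) (h : C -> C) (c : C) :
  power_series a h -> (forall z, disk z -> h z = c) -> forall n, a (S n) = 0%C.
Proof.
  intros Ha Hc n. destruct (power_series_derive _ _ Ha) as [h1 [H1 Hd]].
  apply derived_eq_0, power_series_zero.
  eapply power_series_ext; [reflexivity | | exact H1].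
  intros z Hz. destruct (disk_near z Hz) as [d [Hpos Hn]].
  apply (cderive_unique (fun _ => c) z); [| apply cderive_const].
  eapply cderive_ext_loc; [exact Hpos | | now apply Hd]. intros w Hw. now apply Hc, Hn.
Qed.

Lemma half_plane_map (a : nat -> C) (Phi : C -> C) (e : C) :
  Cmod e = 1 -> power_series a Phi -> a 0%nat = 0%C -> a 1%nat = 1%C ->
  (forall z, disk z -> - (1 / 2) < Re (e * Phi z)%C) ->
  (forall n, a (S n) = Cpow e n) /\ forall z, disk z -> (Phi z * (1 - e * z))%C = z.
Proof.
  intros He Ha H0 H1 Hre.
  destruct (power_series_tail _ _ Ha) as [phi [Hphi E1]].
  destruct (power_series_tail _ _ Hphi) as [psi [Hpsi E2]].
  assert (HE : forall z, disk z -> phi z = (1 + e * (z * phi z))%C).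
  { apply (half_plane_extremal phi psi e He).
    - exact (power_series_twice_derivable _ _ Hphi).
    - exact (power_series_twice_derivable _ _ Hpsi).
    - intros z Hz. rewrite (E2 z Hz), H1. reflexivity.
    - intros z Hz. specialize (Hre z Hz). rewrite (E1 z Hz), H0 in Hre.
      replace (e * (z * phi z))%C with (e * (0 + z * phi z))%C by ring. exact Hre. }
  split.
  2: { intros z Hz. rewrite (E1 z Hz), H0.
       transitivity (z * (phi z - e * (z * phi z)))%C; [ring |].
       rewrite (HE z Hz) at 1. ring. }
  (* The series of [phi z - e * (z * phi z)], which is constantly 1. The vanishing of its higher
     coefficients is the recursion [a (n + 2) = e * a (n + 1)]. *)
  pose proof (power_series_plus _ _ _ _ Hphi
                (power_series_scal (- e)%C _ _ (power_series_shift _ _ Hphi))) as HP.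
  induction n as [| n IH]; [exact H1 |].
  assert (Hn : (a (S (S n)) + - e * a (S n))%C = 0%C).
  { refine (power_series_constant _ _ 1%C HP _ n).
    intros z Hz. simpl. rewrite (HE z Hz) at 1. ring. }
  replace (a (S (S n))) with ((a (S (S n)) + - e * a (S n)) + e * a (S n))%C by ring.
  rewrite Hn, IH. simpl. ring.
Qed.

(** * Level curves on a half-plane *)

Definition right_half (w : C) : Prop := - (1 / 2) < Re w.

(** The Noshiro-Warschawski condition. By the Cauchy-Riemann equations [Re W1] is the derivative of
    [Im W] along vertical lines; the derivative of [W1] is there for the Laplacian argument. *)
Definition positive_primitive (W W1 : C -> C) : Prop :=
  forall w, right_half w -> cderive W w (W1 w) /\ (exists l, cderive W1 w l) /\ 0 < Re (W1 w).

(** Reflection in the real axis changes the sign of [Im W], so that a statement about exceeding a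
    level also yields one about falling below it. *)
Lemma positive_primitive_conj (W W1 : C -> C) :
  positive_primitive W W1 ->
  positive_primitive (fun w => Cconj (W (Cconj w))) (fun w => Cconj (W1 (Cconj w))).
Proof.
  intros H w Hw. destruct (H (Cconj w)) as [H1 [[l H2] H3]]; [exact Hw |].
  split; [now apply cderive_conj_conj |]. split; [| exact H3].
  exists (Cconj l). now apply cderive_conj_conj.
Qed.

Lemma Im_vertical_derive (W W1 : C -> C) (u v : R) :
  positive_primitive W W1 -> - (1 / 2) < u ->
  is_derive (fun t => Im (W (u, t))) v (Re (W1 (u, v))).
Proof.
  intros H Hu. destruct (H (u, v) Hu) as [H1 _]. exact (proj2 (cderive_vertical W (u, v) _ H1)).
Qed.

Lemma Im_increasing (W W1 : C -> C) (u v v' : R) :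
  positive_primitive W W1 -> - (1 / 2) < u -> v < v' -> Im (W (u, v)) < Im (W (u, v')).
Proof.
  intros H Hu Hv.
  apply (incr_function (fun t => Im (W (u, t))) m_infty p_infty (fun t => Re (W1 (u, t))));
    simpl; auto.
  - intros x _ _. exact (Im_vertical_derive W W1 u x H Hu).
  - intros x _ _. now apply (H (u, x)).
Qed.

Lemma Im_nondecreasing (W W1 : C -> C) (u v v' : R) :
  positive_primitive W W1 -> - (1 / 2) < u -> v <= v' -> Im (W (u, v)) <= Im (W (u, v')).
Proof.
  intros H Hu [Hv | <-]; [| apply Rle_refl]. now apply Rlt_le, (Im_increasing W W1).
Qed.

Lemma Im_injective (W W1 : C -> C) (u v v' : R) :
  positive_primitive W W1 -> - (1 / 2) < u -> Im (W (u, v)) = Im (W (u, v')) -> v = v'.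
Proof.
  intros H Hu E. destruct (Rtotal_order v v') as [L | [L | L]]; [| exact L |];
    apply (Im_increasing W W1 u) in L; auto; lra.
Qed.

Lemma Im_intermediate (W W1 : C -> C) (u v v' c : R) :
  positive_primitive W W1 -> - (1 / 2) < u ->
  Im (W (u, v)) <= c <= Im (W (u, v')) -> exists t, v <= t <= v' /\ Im (W (u, t)) = c.
Proof.
  intros H Hu Hc.
  assert (Hv : v <= v').
  { apply Rnot_lt_le. intros L. apply (Im_increasing W W1 u) in L; auto. lra. }
  destruct (IVT_gen (fun t => Im (W (u, t))) v v' c) as [t [Ht E]].
  - intros t. apply derivable_continuous_pt. exists (Re (W1 (u, t))).
    apply is_derive_Reals. now apply (Im_vertical_derive W W1).
  - rewrite Rmin_left, Rmax_right by lra. exact Hc.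
  - rewrite Rmin_left, Rmax_right in Ht by lra. now exists t.
Qed.

(* If [Im W <= c] on the whole line [Re w = u2], compare [Im W - c - delta] with a small multiple of
   [(v - V)^2 + 2 (u - u1) (u3 - u)], which is strictly superharmonic, on a tall rectangle centred
   at height [V]. *)
Lemma level_exceeded (W W1 : C -> C) (u1 u2 u3 v1 v3 c : R) :
  positive_primitive W W1 -> - (1 / 2) < u1 -> u1 < u2 < u3 ->
  Im (W (u1, v1)) = c -> Im (W (u3, v3)) = c -> exists v, c < Im (W (u2, v)).
Proof.
  intros H Hu1 Hu E1 E3. apply NNPP. intros Hno.
  assert (Hle : forall v, Im (W (u2, v)) <= c).
  { intros v. apply Rnot_lt_le. intros L. apply Hno. now exists v. }
  (* Strictly above both given points: by monotonicity the vertical sides over [u1] and [u3] stay at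
     least [delta > 0] above [c] from this height on. *)
  set (v0 := Rmax v1 v3 + 1).
  assert (Hv1 : v1 < v0) by (unfold v0; pose proof (Rmax_l v1 v3); lra).
  assert (Hv3 : v3 < v0) by (unfold v0; pose proof (Rmax_r v1 v3); lra).
  assert (G1 : c < Im (W (u1, v0))) by (rewrite <- E1; apply (Im_increasing W W1); auto).
  assert (G3 : c < Im (W (u3, v0))) by (rewrite <- E3; apply (Im_increasing W W1); auto; lra).
  set (delta := Rmin (Im (W (u1, v0))) (Im (W (u3, v0))) - c).
  assert (Hdelta : 0 < delta) by (unfold delta; apply Rlt_0_minus, Rmin_glb_lt; assumption).
  assert (D1 : c + delta <= Im (W (u1, v0)))
    by (unfold delta; pose proof (Rmin_l (Im (W (u1, v0))) (Im (W (u3, v0)))); lra).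
  assert (D3 : c + delta <= Im (W (u3, v0)))
    by (unfold delta; pose proof (Rmin_r (Im (W (u1, v0))) (Im (W (u3, v0)))); lra).
  assert (HRe : forall q, Re (- Ci * W q)%C = Im (W q)) by (intros q; apply Re_mult_opp_Ci).
  assert (Hcont : forall alpha beta a b p, right_half p -> forall eps, 0 < eps -> exists d, 0 < d /\
    forall q, Cmod (q - p) < d ->
      Re (- Ci * W p)%C + alpha * (Re p - a) ^ 2 + beta * (Im p - b) ^ 2 - eps
      < Re (- Ci * W q)%C + alpha * (Re q - a) ^ 2 + beta * (Im q - b) ^ 2).
  { intros alpha beta a b p Hp.
    apply (quadratic_perturbation_continuous (fun q => - Ci * W q)%C p (- Ci * W1 p)%C).
    now apply cderive_scal, H. }
  (* A lower bound on the bottom side, seen as a rectangle of height 0; monotonicity carries it to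
     the top side, whatever the height. *)
  assert (Hbot : exists C0, forall u, u1 <= u <= u3 -> C0 <= Im (W (u, v0))).
  { destruct (compact_min (rectangle u1 u3 v0 v0) (fun q => Im (W q))) as [p [Hp Hmin]].
    - apply rectangle_compact.
    - exists (u1, v0). unfold rectangle, Re, Im; simpl. lra.
    - intros p [Hp _] eps He.
      destruct (Hcont 0 0 0 0 p ltac:(unfold right_half; lra) eps He) as [d [Hd Hq]].
      exists d. split; [exact Hd |]. intros q _ Hlt. specialize (Hq q Hlt).
      rewrite !HRe in Hq. lra.
    - exists (Im (W p)). intros u Hu'. apply Hmin. unfold rectangle, Re, Im; simpl. lra. }
  destruct Hbot as [C0 HC0].
  set (C1 := Rabs (C0 - c) + delta).
  assert (HC1 : 0 < C1) by (unfold C1; pose proof (Rabs_pos (C0 - c)); lra).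
  assert (HC1' : c + delta <= C0 + C1).
  { unfold C1. pose proof (Rle_abs (- (C0 - c))) as T. rewrite Rabs_Ropp in T. lra. }
  set (L := u3 - u1). assert (HL : 0 < L) by (unfold L; lra).
  (* [T] will be half the height. [k * T ^ 2 = C1] lifts the bottom and top sides to at least
     [C0 + C1 >= c + delta], and [T ^ 2 >= X] gives [k * L ^ 2 <= delta], so the horizontal term, at
     most [k * L ^ 2 / 2], costs no more than half of [delta]. *)
  set (X := C1 * L ^ 2 / delta).
  assert (HX : 0 < X).
  { unfold X. apply Rdiv_lt_0_compat; [| exact Hdelta].
    apply Rmult_lt_0_compat; [exact HC1 | apply pow_lt; exact HL]. }
  set (T := 1 + X).
  set (k := C1 / T ^ 2).
  assert (HT2 : 0 < T ^ 2) by (apply pow_lt; unfold T; lra).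
  assert (Hk : 0 < k) by (apply Rdiv_lt_0_compat; assumption).
  assert (HkT : k * T ^ 2 = C1) by (unfold k; field; unfold T; lra).
  assert (HkL : k * L ^ 2 <= delta).
  { apply (Rmult_le_reg_r (T ^ 2)); [exact HT2 |].
    replace (k * L ^ 2 * T ^ 2) with (k * T ^ 2 * L ^ 2) by ring. rewrite HkT.
    replace (C1 * L ^ 2) with (delta * X) by (unfold X; field; lra).
    apply Rmult_le_compat_l; [lra |]. unfold T. nra. }
  set (um := (u1 + u3) / 2). set (V := v0 + T).
  (* The Laplacian is [- 2 * k], which excludes interior minima. On the boundary
     [G >= c + delta / 2], whereas [G <= c] at [(u2, V)]. *)
  set (G := fun q : C => Re (- Ci * W q)%C + - 2 * k * (Re q - um) ^ 2 + k * (Im q - V) ^ 2).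
  assert (HTp : 0 < T) by (unfold T; lra).
  destruct (compact_min (rectangle u1 u3 v0 (v0 + 2 * T)) G) as [p [[Hp1 Hp2] Hmin]].
  - apply rectangle_compact.
  - exists (u1, v0). unfold rectangle, Re, Im; simpl. lra.
  - intros p [Hp _] eps He.
    destruct (Hcont (- 2 * k) k um V p ltac:(unfold right_half; lra) eps He) as [d [Hd Hq]].
    exists d. split; [exact Hd |]. intros q _. apply Hq.
  - assert (Hbound : c + delta - k * L ^ 2 / 2 <= G p).
    { unfold G. rewrite HRe. destruct p as [x y]. unfold Re, Im in Hp1, Hp2; simpl in Hp1, Hp2.
      change (Re (x, y)) with x. change (Im (x, y)) with y.
      assert (Hx : k * (x - um) ^ 2 <= k * (L ^ 2 / 4)).
      { apply Rmult_le_compat_l; [lra |]. unfold um, L. nra. }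
      assert (Hy : 0 <= k * (y - V) ^ 2) by (apply Rmult_le_pos; [lra | apply pow2_ge_0]).
      destruct (Req_dec x u1) as [-> | Nx1].
      { pose proof (Im_nondecreasing W W1 u1 v0 y H Hu1 ltac:(lra)). lra. }
      destruct (Req_dec x u3) as [-> | Nx3].
      { pose proof (Im_nondecreasing W W1 u3 v0 y H ltac:(lra) ltac:(lra)). lra. }
      pose proof (Im_nondecreasing W W1 x v0 y H ltac:(lra) ltac:(lra)) as Hm.
      pose proof (HC0 x ltac:(lra)) as Hb.
      destruct (Req_dec y v0) as [-> | Ny1].
      { replace ((v0 - V) ^ 2) with (T ^ 2) by (unfold V; ring). lra. }
      destruct (Req_dec y (v0 + 2 * T)) as [Ey | Ny3].
      { replace ((y - V) ^ 2) with (T ^ 2) by (rewrite Ey; unfold V; ring). lra. }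
      exfalso.
      set (d := Rmin (Rmin (x - u1) (u3 - x)) (Rmin (y - v0) (v0 + 2 * T - y))).
      assert (Hd : 0 < d) by (unfold d; repeat apply Rmin_pos; lra).
      assert (Hd1 : d <= x - u1) by (unfold d; eapply Rle_trans; apply Rmin_l).
      assert (Hd2 : d <= u3 - x)
        by (unfold d; eapply Rle_trans; [apply Rmin_l | apply Rmin_r]).
      assert (Hd3 : d <= y - v0)
        by (unfold d; eapply Rle_trans; [apply Rmin_r | apply Rmin_l]).
      assert (Hd4 : d <= v0 + 2 * T - y)
        by (unfold d; eapply Rle_trans; [apply Rmin_r | apply Rmin_r]).
      assert (Hin : forall q, Cmod (q - (x, y))%C < d -> rectangle u1 u3 v0 (v0 + 2 * T) q).
      { intros q Hq. pose proof (re_le_Cmod (q - (x, y))%C) as T1.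
        pose proof (im_le_Cmod (q - (x, y))%C) as T2.
        apply Rle_lt_trans with (2 := Hq) in T1. apply Rle_lt_trans with (2 := Hq) in T2.
        apply Rabs_lt_between in T1. apply Rabs_lt_between in T2.
        unfold rectangle, Re, Im in *; simpl in *. lra. }
      assert (Hxp : right_half (x, y)) by (unfold right_half, Re; simpl; lra).
      destruct (H (x, y) Hxp) as [_ [[l Hl] _]].
      pose proof (local_min_laplacian (fun q => - Ci * W q)%C (fun q => - Ci * W1 q)%C (x, y)
                    (- Ci * l)%C (- 2 * k) k d Hd) as LM.
      assert (0 <= - 2 * k + k); [| lra].
      apply LM with (a := um) (b := V).
      - intros q Hq. destruct (Hin q Hq) as [Hq1 _]. apply cderive_scal, H. unfold right_half. lra.
      - now apply cderive_scal.
      - intros q Hq. now apply Hmin, Hin. }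
    assert (Hr : rectangle u1 u3 v0 (v0 + 2 * T) (u2, V)).
    { unfold rectangle, V, Re, Im; simpl. lra. }
    specialize (Hmin (u2, V) Hr). specialize (Hle V).
    unfold G at 2 in Hmin. rewrite HRe in Hmin.
    change (Re (u2, V)) with u2 in Hmin. change (Im (u2, V)) with V in Hmin.
    replace ((V - V) ^ 2) with 0 in Hmin by ring.
    assert (0 <= k * (u2 - um) ^ 2) by (apply Rmult_le_pos; [lra | apply pow2_ge_0]).
    lra.
Qed.

Lemma level_attained (W W1 : C -> C) (u1 u2 u3 v1 v3 c : R) :
  positive_primitive W W1 -> - (1 / 2) < u1 -> u1 <= u2 <= u3 ->
  Im (W (u1, v1)) = c -> Im (W (u3, v3)) = c -> exists v, Im (W (u2, v)) = c.
Proof.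
  intros H Hu1 Hu E1 E3.
  destruct (Req_dec u1 u2) as [<- | N1]; [now exists v1 |].
  destruct (Req_dec u2 u3) as [-> | N3]; [now exists v3 |].
  assert (Hu' : u1 < u2 < u3) by lra.
  destruct (level_exceeded W W1 u1 u2 u3 v1 v3 c H Hu1 Hu' E1 E3) as [v Hv].
  (* The reflected map gives a point of the same vertical line with [Im W < c]; the intermediate
     value theorem finishes. *)
  destruct (level_exceeded _ _ u1 u2 u3 (- v1) (- v3) (- c) (positive_primitive_conj W W1 H) Hu1 Hu')
    as [v' Hv'].
  - unfold Cconj, Im in *; simpl. rewrite Ropp_involutive. now rewrite E1.
  - unfold Cconj, Im in *; simpl. rewrite Ropp_involutive. now rewrite E3.
  - change (- c < - Im (W (u2, - v'))) in Hv'.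
    destruct (Im_intermediate W W1 u2 (- v') v c H) as [t [_ Ht]]; [lra | lra |].
    now exists t.
Qed.

(** The existence half of the implicit function theorem, by strict monotonicity on vertical lines:
    the level through [(u0, v0)] is trapped between heights [v0 - eta] and [v0 + eta] on nearby
    lines. *)
Lemma level_straddle (W W1 : C -> C) (u0 v0 eta : R) :
  positive_primitive W W1 -> - (1 / 2) < u0 -> 0 < eta ->
  exists d, 0 < d /\ forall u, Rabs (u - u0) < d ->
    - (1 / 2) < u /\ Im (W (u, v0 - eta)) < Im (W (u0, v0)) < Im (W (u, v0 + eta)).
Proof.
  intros H Hu0 Heta.
  assert (Hc : forall v eps, 0 < eps -> exists d, 0 < d /\ forall u, Rabs (u - u0) < d ->
            Rabs (Im (W (u, v)) - Im (W (u0, v))) < eps).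
  { intros v eps He. destruct (cderive_continuous W (u0, v) (W1 (u0, v)) (proj1 (H (u0, v) Hu0)) eps He)
      as [d [Hd Hw]].
    exists d. split; [exact Hd |]. intros u Hlt.
    replace (Im (W (u, v)) - Im (W (u0, v))) with (Im (W (u, v) - W (u0, v))%C)
      by (unfold Im; simpl; ring).
    eapply Rle_lt_trans; [apply im_le_Cmod |]. apply Hw.
    eapply Rle_lt_trans; [apply Cmod_le_abs |].
    unfold Re, Im; simpl. replace (v + - v) with 0 by ring. rewrite Rabs_R0, Rplus_0_r. exact Hlt. }
  pose proof (Im_increasing W W1 u0 (v0 - eta) v0 H Hu0 ltac:(lra)) as Ha.
  pose proof (Im_increasing W W1 u0 v0 (v0 + eta) H Hu0 ltac:(lra)) as Hb.
  destruct (Hc (v0 - eta) (Im (W (u0, v0)) - Im (W (u0, v0 - eta)))) as [d1 [Hd1 K1]]; [lra |].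
  destruct (Hc (v0 + eta) (Im (W (u0, v0 + eta)) - Im (W (u0, v0)))) as [d2 [Hd2 K2]]; [lra |].
  exists (Rmin (u0 + 1 / 2) (Rmin d1 d2)). split; [repeat apply Rmin_pos; lra |].
  intros u Hu.
  assert (A0 : Rabs (u - u0) < u0 + 1 / 2) by (eapply Rlt_le_trans; [exact Hu | apply Rmin_l]).
  assert (A1 : Rabs (u - u0) < d1).
  { eapply Rlt_le_trans; [exact Hu |]. eapply Rle_trans; [apply Rmin_r | apply Rmin_l]. }
  assert (A2 : Rabs (u - u0) < d2).
  { eapply Rlt_le_trans; [exact Hu |]. eapply Rle_trans; [apply Rmin_r | apply Rmin_r]. }
  specialize (K1 u A1). specialize (K2 u A2).
  apply Rabs_lt_between in A0. apply Rabs_lt_between in K1. apply Rabs_lt_between in K2. lra.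
Qed.

(** Each vertical line carries at most one point of the level, so any selection [V] is continuous by
    [level_straddle]; the slope then follows from the linear part of [Im W]. *)
Lemma level_curve_derive (W W1 : C -> C) (V : R -> R) (u0 c rho : R) :
  positive_primitive W W1 -> - (1 / 2) < u0 -> 0 < rho ->
  (forall u, Rabs (u - u0) < rho -> Im (W (u, V u)) = c) ->
  is_derive V u0 (- Im (W1 (u0, V u0)) / Re (W1 (u0, V u0))).
Proof.
  intros H Hu0 Hrho HV. set (w0 := ((u0, V u0) : C)).
  destruct (H w0 Hu0) as [HW [_ Hpos]].
  set (p := Re (W1 w0)) in *. set (q := Im (W1 w0)).
  assert (Ec : Im (W w0) = c).
  { apply HV. rewrite Rminus_diag, Rabs_R0. exact Hrho. }
  assert (Hcont : forall eta, 0 < eta -> exists d, 0 < d /\ forall u, Rabs (u - u0) < d ->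
            Rabs (V u - V u0) < eta).
  { intros eta Heta.
    destruct (level_straddle W W1 u0 (V u0) eta H Hu0 Heta) as [d [Hd K]].
    exists (Rmin d rho). split; [now apply Rmin_pos |]. intros u Hu.
    assert (Hu1 : Rabs (u - u0) < d) by (eapply Rlt_le_trans; [exact Hu | apply Rmin_l]).
    assert (Hu2 : Rabs (u - u0) < rho) by (eapply Rlt_le_trans; [exact Hu | apply Rmin_r]).
    destruct (K u Hu1) as [Kp [K1 K2]]. fold w0 in K1, K2. rewrite Ec, <- (HV u Hu2) in K1, K2.
    apply Rabs_def1; apply Rnot_le_lt; intros L.
    - assert (L' : V u0 + eta <= V u) by lra.
      apply (Im_nondecreasing W W1 u _ _ H Kp) in L'. lra.
    - assert (L' : V u <= V u0 - eta) by lra.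
      apply (Im_nondecreasing W W1 u _ _ H Kp) in L'. lra. }
  apply is_derive_eps. intros eps Heps.
  (* With increments [h] and [k], the level equation reads [|q h + p k| <= e (|h| + |k|)]. For
     [e <= p / 2] the increment [k] can be absorbed, giving [|h| + |k| <= B |h|]; then
     [e <= eps * p / B] yields the error [eps |h|]. *)
  set (B := 1 + 2 / p * (Rabs q + p / 2)).
  assert (HB : 0 < B).
  { unfold B. assert (0 <= 2 / p * (Rabs q + p / 2)); [| lra].
    apply Rmult_le_pos; [apply Rlt_le, Rdiv_lt_0_compat; lra |]. pose proof (Rabs_pos q). lra. }
  set (e := Rmin (p / 2) (eps * p / B)).
  assert (He : 0 < e).
  { apply Rmin_pos; [lra |]. apply Rdiv_lt_0_compat; [nra | exact HB]. }
  destruct (proj1 (cderive_eps _ _ _) HW e He) as [d [Hd Hw]].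
  destruct (Hcont (d / 2)) as [d2 [Hd2 HVc]]; [lra |].
  exists (Rmin (Rmin rho d2) (d / 2)). split; [repeat apply Rmin_pos; lra |].
  intros u Hu.
  assert (A1 : Rabs (u - u0) < rho).
  { eapply Rlt_le_trans; [exact Hu |]. eapply Rle_trans; apply Rmin_l. }
  assert (A2 : Rabs (u - u0) < d2).
  { eapply Rlt_le_trans; [exact Hu |]. eapply Rle_trans; [apply Rmin_l | apply Rmin_r]. }
  assert (A3 : Rabs (u - u0) < d / 2) by (eapply Rlt_le_trans; [exact Hu | apply Rmin_r]).
  specialize (HVc u A2).
  set (h := u - u0) in *. set (k := V u - V u0) in *.
  assert (HD : Cmod ((u, V u) - w0)%C <= Rabs h + Rabs k) by apply Cmod_le_abs.
  specialize (Hw (u, V u) ltac:(lra)).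
  assert (Hqk : Rabs (q * h + p * k) <= e * (Rabs h + Rabs k)).
  { eapply Rle_trans; [| eapply Rle_trans; [exact Hw |]].
    - eapply Rle_trans; [| apply im_le_Cmod].
      replace (Im (W (u, V u) - W w0 - ((u, V u) - w0) * W1 w0)%C) with (- (q * h + p * k)).
      + rewrite Rabs_Ropp. apply Rle_refl.
      + assert (EE : Im (W (u, V u)) = Im (W w0)) by (rewrite Ec; now apply HV).
        unfold q, p, h, k. unfold Im, Re in *. simpl. rewrite EE. ring.
    - apply Rmult_le_compat_l; [lra | exact HD]. }
  assert (He1 : e <= p / 2) by apply Rmin_l. assert (He2 : e <= eps * p / B) by apply Rmin_r.
  assert (Hk : p * Rabs k <= Rabs q * Rabs h + e * (Rabs h + Rabs k)).
  { replace (p * Rabs k) with (Rabs (p * k)) by (rewrite Rabs_mult, (Rabs_pos_eq p); lra).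
    replace (p * k) with ((q * h + p * k) + - (q * h)) by ring.
    eapply Rle_trans; [apply Rabs_triang |]. rewrite Rabs_Ropp, (Rabs_mult q h). lra. }
  assert (Hhp : 0 <= Rabs h) by apply Rabs_pos. assert (Hkp : 0 <= Rabs k) by apply Rabs_pos.
  assert (HkB : Rabs h + Rabs k <= B * Rabs h).
  { assert (Hk2 : p / 2 * Rabs k <= (Rabs q + p / 2) * Rabs h) by nra.
    apply (Rmult_le_reg_l (p / 2)); [lra |].
    unfold B. replace (p / 2 * ((1 + 2 / p * (Rabs q + p / 2)) * Rabs h))
      with (p / 2 * Rabs h + (Rabs q + p / 2) * Rabs h) by (field; lra). lra. }
  replace (k - h * (- q / p)) with ((q * h + p * k) / p) by (field; lra).
  unfold Rdiv. rewrite Rabs_mult, (Rabs_pos_eq (/ p)) by (apply Rlt_le, Rinv_0_lt_compat; lra).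
  apply (Rmult_le_reg_r p); [lra |]. rewrite Rmult_assoc, Rinv_l, Rmult_1_r by lra.
  eapply Rle_trans; [exact Hqk |].
  apply Rle_trans with (eps * p / B * (B * Rabs h)).
  - apply Rmult_le_compat; lra.
  - right. field. lra.
Qed.

(** * The shear construction *)

Lemma level_curve (W W1 : C -> C) (w1 w3 : C) (c : R) :
  positive_primitive W W1 -> right_half w1 -> right_half w3 -> Re w1 < Re w3 ->
  Im (W w1) = c -> Im (W w3) = c ->
  exists V : R -> R, V (Re w1) = Im w1 /\ V (Re w3) = Im w3 /\
    forall u, Re w1 <= u <= Re w3 -> Im (W (u, V u)) = c /\
      is_derive V u (- Im (W1 (u, V u)) / Re (W1 (u, V u))).
Proof.
  destruct w1 as [u1 v1], w3 as [u3 v3]. unfold right_half.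
  change (Re (u1, v1)) with u1. change (Re (u3, v3)) with u3.
  change (Im (u1, v1)) with v1. change (Im (u3, v3)) with v3.
  intros H Hu1 Hu3 Hu E1 E3.
  (* The graph is continued a little beyond both ends, so that [V] has two-sided derivatives on the
     closed interval. *)
  destruct (level_straddle W W1 u1 v1 1 H Hu1 Rlt_0_1) as [d1 [Hd1 K1]].
  destruct (level_straddle W W1 u3 v3 1 H Hu3 Rlt_0_1) as [d3 [Hd3 K3]].
  rewrite E1 in K1. rewrite E3 in K3.
  assert (Hex : forall u, exists v, u1 - d1 < u < u3 + d3 -> Im (W (u, v)) = c).
  { intros u. destruct (classic (u1 - d1 < u < u3 + d3)) as [Hin | Hout]; [| exists 0; tauto].
    destruct (Rlt_le_dec u u1) as [L1 | L1].
    - destruct (K1 u) as [Kp K]; [apply Rabs_def1; lra |].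
      destruct (Im_intermediate W W1 u (v1 - 1) (v1 + 1) c H Kp) as [t [_ Ht]]; [lra |].
      now exists t.
    - destruct (Rlt_le_dec u3 u) as [L3 | L3].
      + destruct (K3 u) as [Kp K]; [apply Rabs_def1; lra |].
        destruct (Im_intermediate W W1 u (v3 - 1) (v3 + 1) c H Kp) as [t [_ Ht]]; [lra |].
        now exists t.
      + destruct (level_attained W W1 u1 u u3 v1 v3 c H Hu1) as [v Hv]; auto. now exists v. }
  set (V := fun u => proj1_sig (constructive_indefinite_description _ (Hex u))).
  assert (HV : forall u, u1 - d1 < u < u3 + d3 -> Im (W (u, V u)) = c).
  { intros u Hin. unfold V.
    now destruct (constructive_indefinite_description _ (Hex u)) as [v Hv]; apply Hv. }
  exists V. split; [| split].
  - apply (Im_injective W W1 u1); auto. rewrite E1. apply HV. lra.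
  - apply (Im_injective W W1 u3); auto. rewrite E3. apply HV. lra.
  - intros u Hin. split; [apply HV; lra |].
    apply (level_curve_derive W W1 V u c (Rmin d1 d3) H); [lra | now apply Rmin_pos |].
    intros t Ht. apply HV.
    assert (A1 : Rabs (t - u) < d1) by (eapply Rlt_le_trans; [exact Ht | apply Rmin_l]).
    assert (A3 : Rabs (t - u) < d3) by (eapply Rlt_le_trans; [exact Ht | apply Rmin_r]).
    apply Rabs_lt_between in A1. apply Rabs_lt_between in A3. lra.
Qed.

(* The hypotheses of Clunie and Sheil-Small's shear construction in the horizontal direction, for
   the harmonic function [h + conj g] on the half-plane [right_half]. *)
Definition shear (h h1 g g1 : C -> C) : Prop :=
  positive_primitive (fun w => h w - g w)%C (fun w => h1 w - g1 w)%C /\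
  forall w, right_half w -> cderive h w (h1 w) /\ cderive g w (g1 w) /\ Cmod (g1 w) < Cmod (h1 w).

Lemma shear_level (h h1 g g1 : C -> C) (w1 w3 : C) :
  shear h h1 g g1 -> right_half w1 -> right_half w3 -> Re w1 < Re w3 ->
  let f := fun w => (h w + Cconj (g w))%C in
  Im (f w1) = Im (f w3) ->
  Re (f w1) < Re (f w3) /\
  forall x, Re (f w1) <= x <= Re (f w3) -> exists w2, right_half w2 /\ f w2 = (x, Im (f w1)).
Proof.
  intros [HW Hs] Hw1 Hw3 Hlt f Ef.
  set (W := fun w => (h w - g w)%C) in *. set (W1 := fun w => (h1 w - g1 w)%C) in *.
  assert (HIm : forall w, Im (f w) = Im (W w)) by (intros w; unfold f, W, Im; simpl; ring).
  set (c := Im (f w1)).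
  destruct (level_curve W W1 w1 w3 c HW Hw1 Hw3 Hlt) as [V [V1 [V3 HV]]].
  { now rewrite <- HIm. } { now rewrite <- HIm, <- Ef. }
  assert (Hhp : forall u, Re w1 <= u <= Re w3 -> right_half (u, V u)).
  { intros u Hu. unfold right_half in *. change (Re (u, V u)) with u. lra. }
  set (r := fun u => Re (f (u, V u))).
  (* The tangent [1 + i V'] equals [conj(h1 - g1) / Re (h1 - g1)], and [Re ((h1 + g1) conj(h1 - g1))
     = |h1|^2 - |g1|^2]. *)
  set (r1 := fun u => (Cmod (h1 (u, V u)) ^ 2 - Cmod (g1 (u, V u)) ^ 2) / Re (W1 (u, V u))).
  assert (Hr : forall u, Re w1 <= u <= Re w3 -> is_derive r u (r1 u)).
  { intros u Hu. destruct (HV u Hu) as [_ HVd]. destruct (Hs _ (Hhp u Hu)) as [Dh [Dg _]].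
    destruct (HW _ (Hhp u Hu)) as [_ [_ Hpos]].
    pose proof (cderive_curve (fun w => h w + g w)%C (u, V u) (h1 (u, V u) + g1 (u, V u))%C
                  (fun t => t) V _ _ u (is_derive_id u) HVd eq_refl
                  (cderive_plus _ _ _ _ _ Dh Dg)) as D.
    match type of D with is_derive _ _ ?l => replace (r1 u) with l end.
    - eapply is_derive_ext; [| exact D]. intros t. unfold r, f, Re; simpl. ring.
    - unfold r1. rewrite !Cmod2_alt. change (@one R_AbsRing) with 1. unfold W1, Re, Im in *. simpl in *.
      field. lra. }
  assert (Er1 : r (Re w1) = Re (f w1)) by (unfold r; rewrite V1; now destruct w1).
  assert (Er3 : r (Re w3) = Re (f w3)) by (unfold r; rewrite V3; now destruct w3).
  split.
  - destruct (MVT_cor2 r r1 (Re w1) (Re w3) Hlt) as [t [Ht Hin]].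
    + intros u Hu. now apply is_derive_Reals, Hr.
    + assert (Hpos : 0 < r1 t).
      { assert (Hin' : Re w1 <= t <= Re w3) by lra. unfold r1. apply Rdiv_lt_0_compat.
        - destruct (Hs _ (Hhp t Hin')) as [_ [_ Hm]]. pose proof (Cmod_ge_0 (g1 (t, V t))). nra.
        - apply (HW _ (Hhp t Hin')). }
      rewrite Er1, Er3 in Ht. nra.
  - intros x Hx. rewrite <- Er1, <- Er3 in Hx.
    destruct (Ranalysis5.f_interv_is_interv r (Re w1) (Re w3) x Hlt Hx) as [t [Ht E]].
    + intros u Hu. apply derivable_continuous_pt. exists (r1 u). now apply is_derive_Reals, Hr.
    + exists (t, V t). split; [now apply Hhp |].
      apply injective_projections; [exact E |].
      change (Im (f (t, V t)) = c). rewrite HIm. now apply HV.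
Qed.

Lemma shear_injective (h h1 g g1 : C -> C) (w1 w3 : C) :
  shear h h1 g g1 -> right_half w1 -> right_half w3 ->
  (h w1 + Cconj (g w1))%C = (h w3 + Cconj (g w3))%C -> w1 = w3.
Proof.
  intros Hs Hw1 Hw3 E.
  destruct (Rtotal_order (Re w1) (Re w3)) as [L | [L | L]].
  - destruct (shear_level h h1 g g1 w1 w3 Hs Hw1 Hw3 L) as [Hlt _]; [now rewrite E |].
    rewrite E in Hlt. lra.
  - destruct w1 as [u1 v1], w3 as [u3 v3]. unfold Re in L; simpl in L. subst u3. f_equal.
    apply (Im_injective _ _ u1 v1 v3 (proj1 Hs) Hw1).
    apply (f_equal Im) in E. unfold Im in *; simpl in *. lra.
  - destruct (shear_level h h1 g g1 w3 w1 Hs Hw3 Hw1 L) as [Hlt _]; [now rewrite E |].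
    rewrite E in Hlt. lra.
Qed.

Lemma shear_slice (h h1 g g1 : C -> C) (w1 w3 : C) (x : R) :
  shear h h1 g g1 -> right_half w1 -> right_half w3 ->
  let f := fun w => (h w + Cconj (g w))%C in
  Im (f w1) = Im (f w3) -> Re (f w1) <= x <= Re (f w3) ->
  exists w2, right_half w2 /\ f w2 = (x, Im (f w1)).
Proof.
  intros Hs Hw1 Hw3 f E Hx.
  destruct (Rtotal_order (Re w1) (Re w3)) as [L | [L | L]].
  - now apply (shear_level h h1 g g1 w1 w3 Hs Hw1 Hw3 L).
  - exists w1. split; [exact Hw1 |].
    assert (Ew : w1 = w3).
    { destruct w1 as [u1 v1], w3 as [u3 v3]. unfold Re in L; simpl in L. subst u3. f_equal.
      apply (Im_injective _ _ u1 v1 v3 (proj1 Hs) Hw1).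
      unfold f, Im in *; simpl in *. lra. }
    rewrite <- Ew in Hx. apply injective_projections; [change (Re (f w1) = x); lra | reflexivity].
  - destruct (shear_level h h1 g g1 w3 w1 Hs Hw3 Hw1 L) as [Hlt _]; [now symmetry |].
    exfalso. unfold f in Hx. lra.
Qed.

(** * Half-plane mappings and their convolution *)

(** Translates the normalization at 0 and sense preservation into conditions on [h'] and [g']. Since
    [d_z f] and [d_zbar f] depend on [f] alone, it also identifies the derivatives of two
    decompositions of one function. *)
Lemma wirtinger (f h g : C -> C) (z l m : C) :
  (forall z, disk z -> f z = (h z + Cconj (g z))%C) -> disk z ->
  cderive h z l -> cderive g z m -> d_z f z = l /\ d_zbar f z = Cconj m.
Proof.
  intros Hf Hz Hh Hg.
  destruct (cderive_horizontal h z l Hh) as [H1 H2]. destruct (cderive_vertical h z l Hh) as [H3 H4].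
  destruct (cderive_horizontal g z m Hg) as [G1 G2]. destruct (cderive_vertical g z m Hg) as [G3 G4].
  destruct (disk_near z Hz) as [d [Hd Hnear]].
  assert (Lx : locally (Re z) (fun t : R => f (t, Im z) = (h (t, Im z) + Cconj (g (t, Im z)))%C)).
  { exists (mkposreal d Hd). intros t Ht. apply Hf, Hnear. eapply Rle_lt_trans; [apply Cmod_le_abs |].
    unfold Re, Im; simpl. replace (snd z + - snd z) with 0 by ring.
    rewrite Rabs_R0, Rplus_0_r. exact Ht. }
  assert (Ly : locally (Im z) (fun t : R => f (Re z, t) = (h (Re z, t) + Cconj (g (Re z, t)))%C)).
  { exists (mkposreal d Hd). intros t Ht. apply Hf, Hnear. eapply Rle_lt_trans; [apply Cmod_le_abs |].
    unfold Re, Im; simpl. replace (fst z + - fst z) with 0 by ring.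
    rewrite Rabs_R0, Rplus_0_l. exact Ht. }
  assert (Dx1 : dx (fun w => Re (f w)) z = Re l + Re m).
  { apply is_derive_unique.
    eapply is_derive_ext_loc; [| exact (is_derive_plus _ _ _ _ _ H1 G1)].
    revert Lx. apply filter_imp. intros t ->. reflexivity. }
  assert (Dx2 : dx (fun w => Im (f w)) z = Im l - Im m).
  { apply is_derive_unique.
    eapply is_derive_ext_loc; [| exact (is_derive_minus _ _ _ _ _ H2 G2)].
    revert Lx. apply filter_imp. intros t ->. reflexivity. }
  assert (Dy1 : dy (fun w => Re (f w)) z = - Im l - Im m).
  { apply is_derive_unique.
    eapply is_derive_ext_loc; [| exact (is_derive_plus _ _ _ _ _ H3 G3)].
    revert Ly. apply filter_imp. intros t ->. reflexivity. }
  assert (Dy2 : dy (fun w => Im (f w)) z = Re l - Re m).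
  { apply is_derive_unique.
    eapply is_derive_ext_loc; [| exact (is_derive_minus _ _ _ _ _ H4 G4)].
    revert Ly. apply filter_imp. intros t ->. reflexivity. }
  assert (H20 : RtoC 2 <> 0%C) by (intros E; apply (f_equal Re) in E; rewrite !re_RtoC in E; lra).
  unfold d_z, d_zbar, Cdx, Cdy. rewrite Dx1, Dx2, Dy1, Dy2. split.
  - replace l with ((2 * l) / 2)%C at 5 by (field; exact H20). f_equal.
    apply injective_projections; unfold Re, Im; simpl; ring.
  - replace (Cconj m) with ((2 * Cconj m) / 2)%C by (field; exact H20). f_equal.
    apply injective_projections; unfold Re, Im; simpl; ring.
Qed.

Lemma Cmod_cis (t : R) : Cmod (cis t) = 1.
Proof.
  unfold Cmod, cis; simpl. pose proof (sin2_cos2 t) as H. unfold Rsqr in H.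
  replace (cos t * (cos t * 1) + sin t * (sin t * 1)) with 1 by lra. apply sqrt_1.
Qed.

Lemma unimodular_conj (e : C) : Cmod e = 1 -> (e * Cconj e)%C = 1%C.
Proof. intros H. rewrite <- Cmod2_conj, H. rewrite pow1. reflexivity. Qed.

(** Here [s = 1 / (l + m)], so [(l - m) * s = |s|^2 (l - m) conj(l + m)], with real part
    [|s|^2 (|l|^2 - |m|^2)]. *)
Lemma positive_real_part (l m s : C) :
  Cmod m < Cmod l -> ((l + m) * s)%C = 1%C -> 0 < Re ((l - m) * s)%C.
Proof.
  intros Hlt E.
  assert (Hs : 0 < Cmod s).
  { apply Cmod_gt_0. intros ->. rewrite Cmult_0_r in E. apply (f_equal Re) in E.
    rewrite !re_RtoC in E. lra. }
  replace ((l - m) * s)%C with (RtoC (Cmod s ^ 2) * ((l - m) * Cconj (l + m)))%C.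
  - rewrite re_scal_l. apply Rmult_lt_0_compat; [now apply pow_lt |].
    pose proof (Cmod2_alt l) as A. pose proof (Cmod2_alt m) as B. pose proof (Cmod_ge_0 m).
    replace (Re ((l - m) * Cconj (l + m))%C) with (Cmod l ^ 2 - Cmod m ^ 2)
      by (rewrite A, B; unfold Re, Im; simpl; ring). nra.
  - rewrite Cmod2_conj.
    transitivity ((l - m) * s * Cconj ((l + m) * s))%C; [rewrite Cmult_conj; ring |].
    rewrite E. replace (Cconj 1) with (RtoC 1) by (apply injective_projections; simpl; ring). ring.
Qed.

Lemma S0_half_plane_parts (gamma : R) (f h g : C -> C) (a b : nat -> C) :
  S0_half_plane gamma f -> analytic_parts f h g -> power_series a h -> power_series b g ->
  let e := cis gamma in let c := (Cconj e * Cconj e)%C in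
  (forall n, a (S n) + c * b (S n) = Cpow e n)%C /\
  exists h1 g1, power_series (derived a) h1 /\ power_series (derived b) g1 /\
    forall z, disk z -> 0 < Re ((h1 z - c * g1 z) * ((1 - e * z) * (1 - e * z)))%C.
Proof.
  intros [(_ & Hsp & _ & _ & Hz0 & Hzb0) Himg] (_ & _ & Hh0 & Hg0 & Hf) Ha Hb e c.
  assert (He : Cmod e = 1) by apply Cmod_cis.
  pose proof (unimodular_conj e He) as Hee.
  assert (Ha0 : a 0%nat = 0%C) by (rewrite <- Hh0; symmetry; now apply power_series_at_0).
  assert (Hb0 : b 0%nat = 0%C) by (rewrite <- Hg0; symmetry; now apply power_series_at_0).
  destruct (power_series_derive _ _ Ha) as [h1 [Hh1 Dh]].
  destruct (power_series_derive _ _ Hb) as [g1 [Hg1 Dg]].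
  assert (HW : forall z, disk z -> d_z f z = h1 z /\ d_zbar f z = Cconj (g1 z)).
  { intros z Hz. apply (wirtinger f h g); auto. }
  assert (Ha1 : a 1%nat = 1%C).
  { destruct (HW _ disk_0) as [E _]. rewrite Hz0, (power_series_at_0 _ _ Hh1) in E.
    rewrite E. unfold derived. simpl. ring. }
  assert (Hb1 : b 1%nat = 0%C).
  { destruct (HW _ disk_0) as [_ E]. rewrite Hzb0 in E. apply (f_equal Cconj) in E.
    rewrite Cconj_conj, (power_series_at_0 _ _ Hg1) in E.
    replace (b 1%nat) with (derived b 0) by (unfold derived; simpl; ring).
    rewrite <- E. apply injective_projections; simpl; ring. }
  set (Phi := fun z => (h z + c * g z)%C).
  assert (HPhi : power_series (fun n => a n + c * b n)%C Phi)
    by (apply power_series_plus; [exact Ha | now apply power_series_scal]).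
  destruct (half_plane_map _ Phi e He HPhi) as [Hcoef Hmap].
  { simpl. rewrite Ha0, Hb0. ring. } { simpl. rewrite Ha1, Hb1. ring. }
  (* [e * c * g = conj(e) * g] has the real part of [e * conj(g)], so [e * Phi] and [e * f] have
     equal real parts. *)
  { intros z Hz. assert (Hin : half_plane gamma (f z)) by (apply Himg; now exists z).
    unfold half_plane in Hin. fold e in Hin. rewrite (Hf z Hz) in Hin.
    replace (e * Phi z)%C with (e * h z + (e * Cconj e) * (Cconj e * g z))%C
      by (unfold Phi, c; ring).
    rewrite Hee. unfold Re in *; simpl in *. lra. }
  split; [exact Hcoef |].
  exists h1, g1. split; [exact Hh1 |]. split; [exact Hg1 |]. intros z Hz.
  apply positive_real_part.
  - destruct (HW z Hz) as [E1 E2]. specialize (Hsp z Hz). rewrite E1, E2, Cmod_conj in Hsp.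
    unfold c. rewrite !Cmod_mult, !Cmod_conj, He. lra.
  (* Differentiating [Phi * (1 - e z) = z] gives [Phi' * (1 - e z)^2 = 1], the relation that
     [positive_real_part] takes with [s = (1 - e z)^2]. *)
  - assert (D1 : cderive (fun z => Phi z * (1 - e * z))%C z
                   ((h1 z + c * g1 z) * (1 - e * z) + Phi z * (0 - e * 1))%C).
    { apply (cderive_mult Phi (fun z => 1 - e * z)%C).
      - apply (cderive_plus h (fun z => c * g z)%C); [now apply Dh |].
        now apply cderive_scal, Dg.
      - apply (cderive_minus (fun _ => 1%C) (fun z => e * z)%C); [apply cderive_const |].
        apply (cderive_scal e (fun z => z)), cderive_id. }
    destruct (disk_near z Hz) as [d [Hd Hnear]].
    assert (D2 : ((h1 z + c * g1 z) * (1 - e * z) + Phi z * (0 - e * 1))%C = 1%C).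
    { apply (cderive_unique (fun z => z) z); [| apply cderive_id].
      eapply cderive_ext_loc; [exact Hd | | exact D1]. intros w Hw. simpl. now apply Hmap, Hnear. }
    transitivity (((h1 z + c * g1 z) * (1 - e * z) + Phi z * (0 - e * 1)) * (1 - e * z)
                  + e * (Phi z * (1 - e * z)))%C; [ring |].
    rewrite D2, (Hmap z Hz). ring.
Qed.

Lemma convolution_parts (gamma1 gamma2 : R) (f1 f2 h1 g1 h2 g2 h g : C -> C) :
  S0_half_plane gamma1 f1 -> S0_half_plane gamma2 f2 ->
  analytic_parts f1 h1 g1 -> analytic_parts f2 h2 g2 -> is_conv h1 h2 h -> is_conv g1 g2 g ->
  let e := (cis gamma1 * cis gamma2)%C in
  exists p q u v,
    power_series p h /\ power_series q g /\ power_series (derived p) u /\ power_series (derived q) v /\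
    forall z, disk z ->
      0 < Re ((u z - Cconj e * Cconj e * v z) * ((1 - e * z) * (1 - e * z)))%C.
Proof.
  intros Hf1 Hf2 P1 P2 [a [A [Ha [HA HaA]]]] [b [B [Hb [HB HbB]]]] e.
  destruct (S0_half_plane_parts _ _ _ _ _ _ Hf1 P1 Ha Hb) as (C1 & x1 & y1 & X1 & Y1 & R1).
  destruct (S0_half_plane_parts _ _ _ _ _ _ Hf2 P2 HA HB) as (C2 & x2 & y2 & X2 & Y2 & R2).
  set (e1 := cis gamma1) in *. set (e2 := cis gamma2) in *.
  set (c1 := (Cconj e1 * Cconj e1)%C) in *. set (c2 := (Cconj e2 * Cconj e2)%C) in *.
  assert (He1 : Cmod e1 = 1) by apply Cmod_cis. assert (He2 : Cmod e2 = 1) by apply Cmod_cis.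
  destruct (power_series_derive _ _ HaA) as [u [Hu _]].
  destruct (power_series_derive _ _ HbB) as [v [Hv _]].
  exists (fun n => a n * A n)%C, (fun n => b n * B n)%C, u, v.
  do 4 (split; [assumption |]). intros z Hz.
  assert (Hc : (Cconj e * Cconj e)%C = (c1 * c2)%C) by (unfold e, c1, c2; rewrite Cmult_conj; ring).
  rewrite Hc.
  set (s2 := fun z => (x2 z + (- c2) * y2 z)%C). set (s1 := fun z => (x1 z + (- c1) * y1 z)%C).
  (* On coefficients: [2 (a A - c1 c2 b B) = (a + c1 b) (A - c2 B) + (a - c1 b) (A + c2 B)], where
     the factors with a plus sign are powers of [e1] and [e2]. Such powers amount to a rotation of
     the argument. *)
  assert (H2 : (2 * (u z + (- (c1 * c2)) * v z))%C = (s2 (e1 * z) + s1 (e2 * z))%C).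
  { rewrite power_series_iff in Hu, Hv.
    assert (S1 := power_series_plus _ _ _ _ X1 (power_series_scal (- c1)%C _ _ Y1)).
    assert (S2 := power_series_plus _ _ _ _ X2 (power_series_scal (- c2)%C _ _ Y2)).
    assert (S3 := power_series_plus _ _ _ _ (power_series_rotate e1 _ _ He1 S2)
                    (power_series_rotate e2 _ _ He2 S1)).
    rewrite power_series_iff in S3. specialize (S3 z Hz).
    refine (cseries_unique _ _ _ _ S3).
    eapply cseries_ext; [| reflexivity |
      apply (cseries_scal 2), cseries_plus; [exact (Hu z Hz) | apply cseries_scal; exact (Hv z Hz)]].
    intros n. simpl. unfold derived. rewrite <- (C1 n), <- (C2 n). ring. }
  (* As [e2 * (e1 * z) = e * z], both rotated terms carry the same factor [(1 - e z)^2], so their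
     positivity adds up. *)
  assert (Hp1 : 0 < Re (s2 (e1 * z) * ((1 - e * z) * (1 - e * z)))%C).
  { replace (s2 (e1 * z) * ((1 - e * z) * (1 - e * z)))%C
      with ((x2 (e1 * z) - c2 * y2 (e1 * z)) * ((1 - e2 * (e1 * z)) * (1 - e2 * (e1 * z))))%C
      by (unfold s2, e; ring).
    apply R2. unfold disk. rewrite Cmod_mult, He1, Rmult_1_l. exact Hz. }
  assert (Hp2 : 0 < Re (s1 (e2 * z) * ((1 - e * z) * (1 - e * z)))%C).
  { replace (s1 (e2 * z) * ((1 - e * z) * (1 - e * z)))%C
      with ((x1 (e2 * z) - c1 * y1 (e2 * z)) * ((1 - e1 * (e2 * z)) * (1 - e1 * (e2 * z))))%C
      by (unfold s1, e; ring).
    apply R1. unfold disk. rewrite Cmod_mult, He2, Rmult_1_l. exact Hz. }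
  assert (H3 : 0 < Re (2 * ((u z - c1 * c2 * v z) * ((1 - e * z) * (1 - e * z))))%C).
  { replace (2 * ((u z - c1 * c2 * v z) * ((1 - e * z) * (1 - e * z))))%C
      with ((2 * (u z + (- (c1 * c2)) * v z)) * ((1 - e * z) * (1 - e * z)))%C by ring.
    rewrite H2, Cmult_plus_distr_r, re_plus. lra. }
  rewrite re_scal_l in H3. lra.
Qed.

(** * Images of harmonic maps *)

(** Neighbourhoods in [C] are those of the product of two lines, whose balls are squares. *)
Lemma locally_Cmod (p : C) (U : C -> Prop) :
  locally p U <-> exists d, 0 < d /\ forall q, Cmod (q - p) < d -> U q.
Proof.
  split.
  - intros [d Hd]. exists d. split; [apply cond_pos |]. intros q Hq. apply Hd.
    split; (eapply Rle_lt_trans; [| exact Hq]).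
    + exact (re_le_Cmod (q - p)%C).
    + exact (im_le_Cmod (q - p)%C).
  - intros [d [Hd H]]. assert (Hp : 0 < d / 2) by lra. exists (mkposreal _ Hp).
    intros q [H1 H2]. apply H. eapply Rle_lt_trans; [apply Cmod_le_abs |].
    replace d with (d / 2 + d / 2) by field. now apply Rplus_lt_compat.
Qed.

Lemma path_connected (S : C -> Prop) :
  (forall x y, S x -> S y -> exists path : R -> C, path 0 = x /\ path 1 = y /\
     forall t, 0 <= t <= 1 -> S (path t) /\
       forall eps, 0 < eps -> exists d, 0 < d /\
         forall s, Rabs (s - t) < d -> Cmod (path s - path t) < eps) ->
  connected S.
Proof.
  intros Hpath U V HU HV Hcov Hdisj. apply NNPP. intros Hno.
  apply not_or_and in Hno. destruct Hno as [N1 N2].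
  apply not_all_ex_not in N1. destruct N1 as [x Nx]. apply imply_to_and in Nx.
  apply not_all_ex_not in N2. destruct N2 as [y Ny]. apply imply_to_and in Ny.
  destruct Nx as [Sx Ux]. destruct Ny as [Sy Vy].
  destruct (Hpath x y Sx Sy) as [path [P0 [P1 Hp]]].
  assert (Hnear : forall (O : C -> Prop) t, open O -> 0 <= t <= 1 -> O (path t) -> exists d, 0 < d /\
            forall s, Rabs (s - t) < d -> O (path s)).
  { intros O t HO Ht HOt. destruct (proj1 (locally_Cmod _ _) (HO _ HOt)) as [e [He Hq]].
    destruct (proj2 (Hp t Ht) e He) as [d [Hd Hs]]. exists d. split; [exact Hd |].
    intros s Hlt. now apply Hq, Hs. }
  assert (V0 : V (path 0)).
  { rewrite P0. destruct (Hcov x Sx) as [H | H]; [contradiction | exact H]. }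
  (* At the supremum [m] of the initial segments lying in [V]: membership in [U] would make [U] and
     [V] meet at or just before [m], and membership in [V] would prolong the segment or put [y] in
     [V]. *)
  set (A := fun t => 0 <= t <= 1 /\ forall s, 0 <= s <= t -> V (path s)).
  destruct (completeness A) as [m [Hm1 Hm2]].
  { exists 1. intros t [Ht _]. lra. }
  { exists 0. split; [lra |]. intros s Hs. replace s with 0 by lra. exact V0. }
  assert (Hm : 0 <= m <= 1).
  { split.
    - apply Hm1. split; [lra |]. intros s Hs. replace s with 0 by lra. exact V0.
    - apply Hm2. intros t [Ht _]. lra. }
  assert (Hbelow : forall s, 0 <= s < m -> V (path s)).
  { intros s Hs. apply NNPP. intros Hn. assert (m <= s); [| lra].
    apply Hm2. intros t [Ht HVt]. apply Rnot_lt_le. intros Hlt. apply Hn, HVt. lra. }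
  destruct (Hcov _ (proj1 (Hp m Hm))) as [HUm | HVm].
  - destruct (Hnear U m HU Hm HUm) as [d [Hd Hs]].
    destruct (Req_dec m 0) as [E | N].
    + apply (Hdisj (path m)). split; [now apply Hp |]. split; [exact HUm |]. now rewrite E.
    + set (s := Rmax 0 (m - d / 2)).
      assert (Hs0 : 0 <= s < m) by (split; [apply Rmax_l | apply Rmax_lub_lt; lra]).
      assert (Hsd : m - d / 2 <= s) by apply Rmax_r.
      apply (Hdisj (path s)). split; [apply Hp; lra |]. split; [| now apply Hbelow].
      apply Hs. apply Rabs_def1; lra.
  - destruct (Hnear V m HV Hm HVm) as [d [Hd Hs]].
    assert (HA : forall t, 0 <= t <= 1 -> t < m + d -> A t).
    { intros t Ht Htd. split; [exact Ht |]. intros s Hs'.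
      destruct (Rlt_le_dec s m) as [L | L]; [apply Hbelow; lra |].
      apply Hs. apply Rabs_def1; lra. }
    destruct (Req_dec m 1) as [E | N].
    + apply Vy. rewrite <- P1, <- E. exact HVm.
    + set (t := Rmin 1 (m + d / 2)).
      assert (Ht : m < t) by (apply Rmin_glb_lt; lra).
      assert (Ht1 : t <= 1) by apply Rmin_l. assert (Ht2 : t <= m + d / 2) by apply Rmin_r.
      assert (t <= m); [| lra]. apply Hm1, HA; lra.
Qed.

Lemma circle_compact (p : C) (r : R) : compact_set (fun q => Cmod (q - p) = r).
Proof.
  split.
  - destruct (proj1 (closed_disk_compact p r)) as [M HM]. exists M. intros q Hq. apply HM. lra.
  - intros q Hq. exists (Rabs (Cmod (q - p) - r)). split; [apply Rabs_pos_lt; lra |].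
    intros w Hw E.
    pose proof (Cmod_triangle (w - p) (q - w)) as T1.
    pose proof (Cmod_triangle (q - p) (w - q)) as T2.
    replace (w - p + (q - w))%C with (q - p)%C in T1 by ring.
    replace (q - p + (w - q))%C with (w - p)%C in T2 by ring.
    rewrite (Cmod_sub_sym q w) in T1. unfold Rabs in Hw. destruct Rcase_abs; lra.
Qed.

Definition harmonic_decomposition (f h g u v : C -> C) : Prop :=
  forall z, disk z -> f z = (h z + Cconj (g z))%C /\ cderive h z (u z) /\ cderive g z (v z).

Lemma harmonic_increment (f h g u v : C -> C) (z : C) (eps : R) :
  harmonic_decomposition f h g u v ->
  disk z -> 0 < eps -> exists d, 0 < d /\ forall w, Cmod (w - z) < d ->
    Cmod (f w - f z - ((w - z) * u z + Cconj ((w - z) * v z)))%C <= eps * Cmod (w - z).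
Proof.
  intros Hf Hz He. destruct (disk_near z Hz) as [d0 [Hd0 Hn]].
  destruct (Hf z Hz) as [Ez [Hh Hg]].
  destruct (proj1 (cderive_eps _ _ _) Hh (eps / 2)) as [d1 [Hd1 K1]]; [lra |].
  destruct (proj1 (cderive_eps _ _ _) Hg (eps / 2)) as [d2 [Hd2 K2]]; [lra |].
  exists (Rmin d0 (Rmin d1 d2)). split; [repeat apply Rmin_pos; assumption |].
  intros w Hw.
  assert (A0 : Cmod (w - z) < d0) by (eapply Rlt_le_trans; [exact Hw | apply Rmin_l]).
  assert (A1 : Cmod (w - z) < d1).
  { eapply Rlt_le_trans; [exact Hw |]. eapply Rle_trans; [apply Rmin_r | apply Rmin_l]. }
  assert (A2 : Cmod (w - z) < d2).
  { eapply Rlt_le_trans; [exact Hw |]. eapply Rle_trans; [apply Rmin_r | apply Rmin_r]. }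
  specialize (K1 w A1). specialize (K2 w A2). rewrite Ez, (proj1 (Hf w (Hn w A0))).
  rewrite <- Cmod_conj in K2. rewrite !Cminus_conj in K2.
  replace (h w + Cconj (g w) - (h z + Cconj (g z)) - ((w - z) * u z + Cconj ((w - z) * v z)))%C
    with ((h w - h z - (w - z) * u z) + (Cconj (g w) - Cconj (g z) - Cconj ((w - z) * v z)))%C by ring.
  eapply Rle_trans; [apply Cmod_triangle |]. lra.
Qed.

Lemma harmonic_continuous (f h g u v : C -> C) (z : C) :
  harmonic_decomposition f h g u v -> disk z -> ccontinuous f z.
Proof.
  intros Hf Hz eps He. destruct (harmonic_increment f h g u v z 1 Hf Hz Rlt_0_1) as [d [Hd K]].
  set (M := 1 + Cmod (u z) + Cmod (v z)).
  assert (HM : 0 < M) by (unfold M; pose proof (Cmod_ge_0 (u z)); pose proof (Cmod_ge_0 (v z)); lra).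
  exists (Rmin d (eps / M)). split; [apply Rmin_pos; [exact Hd | now apply Rdiv_lt_0_compat] |].
  intros w Hw.
  assert (A0 : Cmod (w - z) < d) by (eapply Rlt_le_trans; [exact Hw | apply Rmin_l]).
  assert (A1 : Cmod (w - z) < eps / M) by (eapply Rlt_le_trans; [exact Hw | apply Rmin_r]).
  specialize (K w A0).
  apply (Rmult_lt_compat_l M) in A1; [| exact HM].
  replace (M * (eps / M)) with eps in A1 by (field; lra).
  eapply Rle_lt_trans; [| exact A1].
  replace (f w - f z)%C
    with ((f w - f z - ((w - z) * u z + Cconj ((w - z) * v z)))
          + ((w - z) * u z + Cconj ((w - z) * v z)))%C
    by ring.
  eapply Rle_trans; [apply Cmod_triangle |].
  pose proof (Cmod_triangle ((w - z) * u z) (Cconj ((w - z) * v z))) as T.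
  rewrite Cmod_conj, !Cmod_mult in T. unfold M. lra.
Qed.

Lemma image_connected (f h g u v : C -> C) :
  harmonic_decomposition f h g u v -> connected (image f).
Proof.
  intros Hf. apply path_connected. intros x y [z1 [Hz1 <-]] [z2 [Hz2 <-]].
  set (seg := fun t : R => (z1 + RtoC t * (z2 - z1))%C).
  assert (Hseg : forall t, 0 <= t <= 1 -> disk (seg t)).
  { intros t Ht. unfold disk in *. 
    replace (seg t) with (RtoC (1 - t) * z1 + RtoC t * z2)%C
      by (unfold seg; rewrite RtoC_minus; ring).
    eapply Rle_lt_trans; [apply Cmod_triangle |].
    rewrite !Cmod_mult, !Cmod_R, !Rabs_pos_eq by lra.
    destruct (Req_dec t 0) as [-> | N]; [lra |].
    assert (t * Cmod z2 < t * 1) by (apply Rmult_lt_compat_l; lra).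
    assert ((1 - t) * Cmod z1 <= (1 - t) * 1) by (apply Rmult_le_compat_l; lra). lra. }
  exists (fun t => f (seg t)). split; [| split].
  - f_equal. unfold seg. ring.
  - f_equal. unfold seg. ring.
  - intros t Ht. split; [exists (seg t); auto |].
    intros eps He. destruct (harmonic_continuous f h g u v _ Hf (Hseg t Ht) eps He) as [d [Hd K]].
    set (N := Cmod (z2 - z1) + 1).
    assert (HN : 1 <= N) by (unfold N; pose proof (Cmod_ge_0 (z2 - z1)); lra).
    exists (d / N). split; [apply Rdiv_lt_0_compat; lra |]. intros s Hs. apply K.
    replace (seg s - seg t)%C with (RtoC (s - t) * (z2 - z1))%C
      by (unfold seg; rewrite RtoC_minus; ring).
    rewrite Cmod_mult, Cmod_R. pose proof (Rabs_pos (s - t)).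
    apply Rle_lt_trans with (Rabs (s - t) * N); [unfold N; nra |].
    apply (Rmult_lt_compat_r N) in Hs; [| lra].
    replace (d / N * N) with d in Hs by (field; lra). exact Hs.
Qed.

(** The Jacobian [|u|^2 - |v|^2] is positive, so the differential can be inverted and a short step
    towards [w] exists: an interior minimum of [|f - w|] must be a solution of [f = w]. *)
Lemma harmonic_descent (f h g u v : C -> C) (p w : C) (r : R) :
  harmonic_decomposition f h g u v -> Cmod (v p) < Cmod (u p) -> disk p -> 0 < r ->
  f p <> w -> exists q, Cmod (q - p) < r /\ Cmod (f q - w) < Cmod (f p - w).
Proof.
  intros Hf Huv Hp Hr Hne. set (E := (w - f p)%C).
  assert (HE : 0 < Cmod E).
  { apply Cmod_gt_0. intros E0. apply Hne. unfold E in E0.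
    replace (f p) with (w - (w - f p))%C by ring. rewrite E0. ring. }
  set (J := RtoC (Cmod (u p) ^ 2 - Cmod (v p) ^ 2)).
  assert (HJ : J <> 0%C).
  { intros E0. apply (f_equal Re) in E0. unfold J in E0. rewrite !re_RtoC in E0.
    pose proof (Cmod_ge_0 (v p)). nra. }
  (* [delta] solves Df(p) delta = w - f p *)
  set (delta := ((Cconj (u p) * E - Cconj (v p) * Cconj E) / J)%C).
  assert (Hdelta : (delta * u p + Cconj (delta * v p))%C = E).
  { assert (HJc : Cconj J = J) by (unfold J; apply injective_projections; simpl; ring).
    unfold delta. rewrite Cmult_conj, Cdiv_conj, Cminus_conj, !Cmult_conj, !Cconj_conj, HJc by exact HJ.
    assert (EJ : J = (u p * Cconj (u p) - v p * Cconj (v p))%C)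
      by (unfold J; rewrite RtoC_minus, !Cmod2_conj; reflexivity).
    transitivity (E * (u p * Cconj (u p) - v p * Cconj (v p)) / J)%C; [field; exact HJ |].
    rewrite <- EJ. field. exact HJ. }
  set (D := Cmod delta + 1). assert (HD : 1 <= D) by (unfold D; pose proof (Cmod_ge_0 delta); lra).
  destruct (harmonic_increment f h g u v p (Cmod E / (2 * D)) Hf Hp) as [d [Hd K]].
  { apply Rdiv_lt_0_compat; lra. }
  (* A step [t * delta] reduces the linearized distance by [t |E|]; the tolerance [|E| / (2 * D)]
     limits the error to [t |E| / 2]. *)
  set (t := Rmin 1 (Rmin d r / (2 * D))).
  assert (Hm : 0 < Rmin d r) by now apply Rmin_pos.
  assert (Ht0 : 0 < t) by (apply Rmin_pos; [lra | apply Rdiv_lt_0_compat; lra]).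
  assert (Ht1 : t <= 1) by apply Rmin_l.
  assert (HtD : t * D <= Rmin d r / 2).
  { assert (Ht2 : t <= Rmin d r / (2 * D)) by apply Rmin_r.
    apply (Rmult_le_compat_r D) in Ht2; [| lra].
    replace (Rmin d r / (2 * D) * D) with (Rmin d r / 2) in Ht2 by (field; lra). exact Ht2. }
  assert (Hstep : Cmod (RtoC t * delta) <= t * D).
  { rewrite Cmod_mult, Cmod_R, Rabs_pos_eq by lra. apply Rmult_le_compat_l; [lra |]. unfold D. lra. }
  pose proof (Rmin_l d r). pose proof (Rmin_r d r).
  exists (p + RtoC t * delta)%C.
  specialize (K (p + RtoC t * delta)%C).
  replace (p + RtoC t * delta - p)%C with (RtoC t * delta)%C in * by ring.
  split; [lra |]. specialize (K ltac:(lra)).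
  set (q := (p + RtoC t * delta)%C) in *.
  set (A := (f q - f p - (RtoC t * delta * u p + Cconj (RtoC t * delta * v p)))%C) in *.
  assert (Eq : (f q - w)%C = (A + RtoC (t - 1) * E)%C).
  { unfold A. replace (RtoC t * delta * u p + Cconj (RtoC t * delta * v p))%C with (RtoC t * E)%C.
    - rewrite RtoC_minus. unfold E. ring.
    - rewrite <- Hdelta, !Cmult_conj.
      replace (Cconj (RtoC t)) with (RtoC t) by (apply injective_projections; simpl; ring). ring. }
  rewrite Eq. replace (Cmod (f p - w)) with (Cmod E) by (unfold E; apply Cmod_sub_sym).
  eapply Rle_lt_trans; [apply Cmod_triangle |].
  rewrite (Cmod_mult (RtoC (t - 1))), Cmod_R, (Rabs_left1 (t - 1)) by lra.
  assert (HA : Cmod A <= t / 2 * Cmod E).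
  { eapply Rle_trans; [exact K |].
    replace (t / 2 * Cmod E) with (Cmod E / (2 * D) * (t * D)) by (field; lra).
    apply Rmult_le_compat_l; [| exact Hstep]. apply Rlt_le, Rdiv_lt_0_compat; lra. }
  nra.
Qed.

(** Inverse mapping by minimization: with [m] the least value of [|f - f z0|] on a small circle,
    positive by univalence, a target within [m / 2] of [f z0] makes the minimum of [|f - w|]
    interior, and [harmonic_descent] makes it zero. *)
Lemma image_open (f h g u v : C -> C) :
  harmonic_decomposition f h g u v -> (forall z, disk z -> Cmod (v z) < Cmod (u z)) ->
  univalent f -> open (image f).
Proof.
  intros Hf Huv Hinj x [z0 [Hz0 <-]]. apply locally_Cmod.
  set (r := (1 - Cmod z0) / 2).
  assert (Hr : 0 < r) by (unfold disk in Hz0; unfold r; lra).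
  assert (Hball : forall q, Cmod (q - z0) <= r -> disk q).
  { intros q Hq. unfold disk in *. pose proof (Cmod_triangle (q - z0) z0) as T.
    replace (q - z0 + z0)%C with q in T by ring. unfold r in Hq. lra. }
  assert (Hlsc : forall w p, disk p -> forall eps, 0 < eps -> exists d, 0 < d /\
            forall q, Cmod (q - p) < d -> Cmod (f p - w) - eps < Cmod (f q - w)).
  { intros w p Hp eps He. destruct (harmonic_continuous f h g u v p Hf Hp eps He) as [d [Hd K]].
    exists d. split; [exact Hd |]. intros q Hq. specialize (K q Hq).
    pose proof (Cmod_triangle (f q - w) (f p - f q)) as T.
    replace (f q - w + (f p - f q))%C with (f p - w)%C in T by ring.
    rewrite (Cmod_sub_sym (f p) (f q)) in T. lra. }
  destruct (compact_min (fun q => Cmod (q - z0) = r) (fun q => Cmod (f q - f z0))) as [p0 [Hp0 Hmin0]].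
  - apply circle_compact.
  - exists (z0 + RtoC r)%C. replace (z0 + RtoC r - z0)%C with (RtoC r) by ring.
    rewrite Cmod_R. apply Rabs_pos_eq. lra.
  - intros p Hp eps He. destruct (Hlsc (f z0) p (Hball p ltac:(lra)) eps He) as [d [Hd K]].
    exists d. split; [exact Hd |]. auto.
  - set (m := Cmod (f p0 - f z0)) in *.
    assert (Hm : 0 < m).
    { apply Cmod_gt_0. intros E. assert (p0 = z0).
      { apply Hinj; [apply Hball; lra | exact Hz0 |].
        replace (f p0) with (f p0 - f z0 + f z0)%C by ring. rewrite E. ring. }
      subst p0. replace (z0 - z0)%C with (RtoC 0) in Hp0 by ring. rewrite Cmod_0 in Hp0. lra. }
    exists (m / 2). split; [lra |]. intros w Hw.
    destruct (compact_min (fun q => Cmod (q - z0) <= r) (fun q => Cmod (f q - w))) as [p [Hp Hmin]].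
    + apply closed_disk_compact.
    + exists z0. replace (z0 - z0)%C with (RtoC 0) by ring. rewrite Cmod_0. lra.
    + intros p Hp eps He. destruct (Hlsc w p (Hball p Hp) eps He) as [d [Hd K]].
      exists d. split; [exact Hd |]. auto.
    + assert (Hin : Cmod (p - z0) < r).
      { destruct Hp as [L | E]; [exact L |]. exfalso.
        specialize (Hmin0 p E). specialize (Hmin z0).
        replace (z0 - z0)%C with (RtoC 0) in Hmin by ring. rewrite Cmod_0 in Hmin.
        specialize (Hmin (Rlt_le _ _ Hr)). rewrite (Cmod_sub_sym (f z0) w) in Hmin.
        pose proof (Cmod_triangle (f p - w) (w - f z0)) as T.
        replace (f p - w + (w - f z0))%C with (f p - f z0)%C in T by ring. lra. }
      exists p. split; [now apply Hball |]. apply NNPP. intros Hne.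
      destruct (harmonic_descent f h g u v p w (r - Cmod (p - z0)) Hf (Huv p (Hball p Hp)) (Hball p Hp))
        as [q [Hq Hlt]];
        [lra | exact Hne |].
      assert (Hqr : Cmod (q - z0) <= r).
      { pose proof (Cmod_triangle (q - p) (p - z0)) as T.
        replace (q - p + (p - z0))%C with (q - z0)%C in T by ring. lra. }
      specialize (Hmin q Hqr). lra.
Qed.

(** * Convexity of the convolution *)

(** The half-plane consists of the points closer to 0 than to -1, hence [w / (1 + w)] maps it into
    the disk. *)
Lemma right_half_iff (w : C) : right_half w <-> Cmod w < Cmod (1 + w).
Proof.
  pose proof (Cmod2_alt w) as A. pose proof (Cmod2_alt (1 + w)) as B.
  pose proof (Cmod_ge_0 w). pose proof (Cmod_ge_0 (1 + w)).
  assert (E : Cmod (1 + w) ^ 2 = Cmod w ^ 2 + 2 * (Re w + 1 / 2))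
    by (rewrite A, B; unfold Re, Im; simpl; field).
  unfold right_half. split; intros Hw; nra.
Qed.

Lemma right_half_neq (w : C) : right_half w -> (1 + w)%C <> 0%C.
Proof.
  rewrite right_half_iff. intros H E. rewrite E, Cmod_0 in H. pose proof (Cmod_ge_0 w). lra.
Qed.

Lemma disk_neq (e z : C) : Cmod e = 1 -> disk z -> (1 - e * z)%C <> 0%C.
Proof.
  intros He Hz E. assert (E1 : (e * z)%C = 1%C).
  { replace (e * z)%C with (1 - (1 - e * z))%C by ring. rewrite E. ring. }
  apply (f_equal Cmod) in E1. rewrite Cmod_mult, He, Cmod_1 in E1. unfold disk in Hz. lra.
Qed.

Lemma right_half_to_disk (e w : C) : Cmod e = 1 -> right_half w -> disk (Cconj e * (w / (1 + w)))%C.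
Proof.
  intros He Hw. pose proof (right_half_neq w Hw) as Hn. apply right_half_iff in Hw.
  unfold disk. rewrite Cmod_mult, Cmod_conj, He, Rmult_1_l, Cmod_div by exact Hn.
  pose proof (Cmod_ge_0 w). apply (Rmult_lt_reg_r (Cmod (1 + w))); [lra |].
  unfold Rdiv. rewrite Rmult_assoc, Rinv_l; lra.
Qed.

Lemma disk_to_right_half (e z : C) : Cmod e = 1 -> disk z -> right_half (e * z / (1 - e * z))%C.
Proof.
  intros He Hz. pose proof (disk_neq e z He Hz) as Hn. apply right_half_iff.
  replace (1 + e * z / (1 - e * z))%C with (1 / (1 - e * z))%C by (field; exact Hn).
  rewrite !Cmod_div, Cmod_mult, He, Cmod_1 by exact Hn. unfold disk in Hz.
  apply Rmult_lt_compat_r; [apply Rinv_0_lt_compat; now apply Cmod_gt_0 | lra].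
Qed.

Lemma disk_right_half_disk (e z : C) :
  Cmod e = 1 -> disk z ->
  (Cconj e * ((e * z / (1 - e * z)) / (1 + e * z / (1 - e * z))))%C = z.
Proof.
  intros He Hz. pose proof (disk_neq e z He Hz) as Hn.
  replace (1 + e * z / (1 - e * z))%C with (1 / (1 - e * z))%C by (field; exact Hn).
  replace (e * z / (1 - e * z) / (1 / (1 - e * z)))%C with (e * z)%C
    by (field; exact Hn).
  rewrite <- (Cmult_1_l z) at 2. rewrite <- (unimodular_conj e He). ring.
Qed.

Lemma cderive_one_plus (w : C) : cderive (fun w => 1 + w)%C w (0 + 1)%C.
Proof. exact (cderive_plus _ _ _ _ _ (cderive_const 1%C w) (cderive_id w)). Qed.

Lemma cderive_right_half_to_disk (e w : C) :
  right_half w -> cderive (fun w => Cconj e * (w / (1 + w)))%C w (Cconj e * / ((1 + w) * (1 + w)))%C.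
Proof.
  intros Hw. pose proof (right_half_neq w Hw) as Hn.
  apply (cderive_scal (Cconj e) (fun w => w / (1 + w))%C).
  replace (/ ((1 + w) * (1 + w)))%C with ((1 * (1 + w) - w * (0 + 1)) / ((1 + w) * (1 + w)))%C
    by (field; exact Hn).
  exact (cderive_div _ _ _ _ _ Hn (cderive_id w) (cderive_one_plus w)).
Qed.

(** The two parts decompose the map [e f] in the variable [w]. Since [1 - e * zeta w = 1 / (1 + w)],
    the factor [1 / (1 + w)^2] from the chain rule is [(1 - e z)^2] at [z = zeta w], which turns the
    last hypothesis into [Re W1 > 0]. *)
Lemma shear_of_disk (e : C) (h g u v : C -> C) :
  Cmod e = 1 ->
  (forall z, disk z -> cderive h z (u z) /\ cderive g z (v z) /\ Cmod (v z) < Cmod (u z)) ->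
  (forall z, disk z -> (exists l, cderive u z l) /\ (exists l, cderive v z l)) ->
  (forall z, disk z ->
     0 < Re ((u z - Cconj e * Cconj e * v z) * ((1 - e * z) * (1 - e * z)))%C) ->
  let zeta := fun w => (Cconj e * (w / (1 + w)))%C in
  shear (fun w => e * h (zeta w))%C (fun w => u (zeta w) * / ((1 + w) * (1 + w)))%C
    (fun w => Cconj e * g (zeta w))%C
    (fun w => Cconj e * Cconj e * v (zeta w) * / ((1 + w) * (1 + w)))%C.
Proof.
  intros He H1 H2 Hpos zeta. pose proof (unimodular_conj e He) as Hee.
  assert (Hd : forall w, right_half w -> cderive (fun w => e * h (zeta w))%C w
              (u (zeta w) * / ((1 + w) * (1 + w)))%C /\
            cderive (fun w => Cconj e * g (zeta w))%C w
              (Cconj e * Cconj e * v (zeta w) * / ((1 + w) * (1 + w)))%C).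
  { intros w Hw. destruct (H1 _ (right_half_to_disk e w He Hw)) as [Dh [Dg _]].
    pose proof (cderive_right_half_to_disk e w Hw) as Dz. split.
    - replace (u (zeta w) * / ((1 + w) * (1 + w)))%C
        with (e * ((Cconj e * / ((1 + w) * (1 + w))) * u (zeta w)))%C.
      + apply (cderive_scal e (fun w => h (zeta w))). now apply (cderive_comp h zeta).
      + transitivity (e * Cconj e * (u (zeta w) * / ((1 + w) * (1 + w))))%C; [ring |].
        rewrite Hee. ring.
    - replace (Cconj e * Cconj e * v (zeta w) * / ((1 + w) * (1 + w)))%C
        with (Cconj e * ((Cconj e * / ((1 + w) * (1 + w))) * v (zeta w)))%C by ring.
      apply (cderive_scal (Cconj e) (fun w => g (zeta w))). now apply (cderive_comp g zeta). }
  split.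
  - intros w Hw. destruct (Hd w Hw) as [Dh Dg]. pose proof (right_half_neq w Hw) as Hn.
    pose proof (right_half_to_disk e w He Hw) as Hz.
    pose proof (cderive_right_half_to_disk e w Hw) as Dz.
    split; [now apply (cderive_minus (fun w => e * h (zeta w))%C (fun w => Cconj e * g (zeta w))%C) |].
    split.
    + destruct (H2 _ Hz) as [[l Hl] [m Hm]].
      assert (Di : exists k, cderive (fun w => / ((1 + w) * (1 + w)))%C w k).
      { eexists. apply (cderive_inv (fun w => (1 + w) * (1 + w))%C); [now apply Cmult_neq_0 |].
        exact (cderive_mult _ _ _ _ _ (cderive_one_plus w) (cderive_one_plus w)). }
      destruct Di as [k Hk]. eexists.
      apply (cderive_minus (fun w => u (zeta w) * / ((1 + w) * (1 + w)))%C
               (fun w => Cconj e * Cconj e * v (zeta w) * / ((1 + w) * (1 + w)))%C).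
      * apply (cderive_mult (fun w => u (zeta w))); [| exact Hk].
        apply (cderive_comp u zeta); [exact Hl | exact Dz].
      * apply (cderive_mult (fun w => Cconj e * Cconj e * v (zeta w))%C); [| exact Hk].
        apply (cderive_scal _ (fun w => v (zeta w))).
        apply (cderive_comp v zeta); [exact Hm | exact Dz].
    + specialize (Hpos _ Hz).
      replace (u (zeta w) * / ((1 + w) * (1 + w))
               - Cconj e * Cconj e * v (zeta w) * / ((1 + w) * (1 + w)))%C
        with ((u (zeta w) - Cconj e * Cconj e * v (zeta w))
              * ((1 - e * zeta w) * (1 - e * zeta w)))%C; [exact Hpos |].
      replace (1 - e * zeta w)%C with (/ (1 + w))%C.
      * field. exact Hn.
      * unfold zeta. transitivity (1 - e * Cconj e * (w / (1 + w)))%C; [| ring].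
        rewrite Hee. field. exact Hn.
  - intros w Hw. destruct (Hd w Hw) as [Dh Dg]. split; [exact Dh |]. split; [exact Dg |].
    pose proof (right_half_neq w Hw) as Hn.
    destruct (H1 _ (right_half_to_disk e w He Hw)) as [_ [_ Hlt]].
    rewrite !Cmod_mult, Cmod_conj, He, !Rmult_1_l.
    apply Rmult_lt_compat_r; [| exact Hlt].
    apply Cmod_gt_0. intros E. apply (C1_nz).
    transitivity (((1 + w) * (1 + w)) * / ((1 + w) * (1 + w)))%C; [field; exact Hn |].
    rewrite E. ring.
Qed.

Lemma slice_connected (phi : R) (S : C -> Prop) (p : C) :
  (forall t1 t2 t, t1 <= t <= t2 -> S (p + RtoC t1 * cis phi)%C -> S (p + RtoC t2 * cis phi)%C ->
     S (p + RtoC t * cis phi)%C) ->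
  connected (fun w => S w /\ line phi p w).
Proof.
  intros H. apply path_connected. intros x y [Sx [t1 ->]] [Sy [t2 ->]].
  exists (fun s => p + RtoC (t1 + s * (t2 - t1)) * cis phi)%C. split; [| split].
  - f_equal. f_equal. f_equal. ring.
  - f_equal. f_equal. f_equal. ring.
  - intros t Ht. split; [split; [| now eexists] |].
    + destruct (Rle_lt_dec t1 t2) as [L | L].
      * apply (H t1 t2); auto. nra.
      * apply (H t2 t1); auto. nra.
    + intros eps He. set (N := Rabs (t2 - t1) + 1).
      assert (HN : 1 <= N) by (unfold N; pose proof (Rabs_pos (t2 - t1)); lra).
      exists (eps / N). split; [apply Rdiv_lt_0_compat; lra |]. intros s Hs.
      replace (p + RtoC (t1 + s * (t2 - t1)) * cis phi - (p + RtoC (t1 + t * (t2 - t1)) * cis phi))%C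
        with (RtoC ((s - t) * (t2 - t1)) * cis phi)%C
        by (rewrite !RtoC_plus, !RtoC_mult, !RtoC_minus; ring).
      rewrite Cmod_mult, Cmod_cis, Rmult_1_r, Cmod_R, Rabs_mult. pose proof (Rabs_pos (s - t)).
      apply Rle_lt_trans with (Rabs (s - t) * N); [unfold N; nra |].
      apply (Rmult_lt_compat_r N) in Hs; [| lra].
      replace (eps / N * N) with eps in Hs by (field; lra). exact Hs.
Qed.

Lemma cis_plus (s t : R) : (cis s * cis t)%C = cis (s + t).
Proof. unfold cis. rewrite cos_plus, sin_plus. apply injective_projections; simpl; ring. Qed.

Theorem theorem2 :
  forall (gamma1 gamma2 : R) (f1 f2 f : C -> C),
    0 <= gamma1 < 2 * PI ->
    0 <= gamma2 < 2 * PI ->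
    S0_half_plane gamma1 f1 ->
    S0_half_plane gamma2 f2 ->
    is_harmonic_conv f1 f2 f ->
    locally_univalent f ->
    convex_in_direction (- (gamma1 + gamma2)) f.
Proof.
  intros gamma1 gamma2 f1 f2 f _ _ Hf1 Hf2 (h1 & g1 & h2 & g2 & h & g & P1 & P2 & Ch & Cg & Hf) Hlu.
  destruct (convolution_parts _ _ _ _ _ _ _ _ _ _ Hf1 Hf2 P1 P2 Ch Cg)
    as (p & q & u & v & Hp & Hq & Hu & Hv & Hpos).
  rewrite cis_plus in Hpos. set (theta := gamma1 + gamma2) in *. set (e := cis theta) in *.
  assert (He : Cmod e = 1) by apply Cmod_cis.
  pose proof (unimodular_conj e He) as Hee.
  assert (Dh : forall z, disk z -> cderive h z (u z)).
  { destruct (power_series_derive _ _ Hp) as [u' [Hu' D]]. intros z Hz.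
    replace (u z) with (u' z); [now apply D |].
    rewrite power_series_iff in Hu, Hu'. exact (cseries_unique _ _ _ (Hu' z Hz) (Hu z Hz)). }
  assert (Dg : forall z, disk z -> cderive g z (v z)).
  { destruct (power_series_derive _ _ Hq) as [v' [Hv' D]]. intros z Hz.
    replace (v z) with (v' z); [now apply D |].
    rewrite power_series_iff in Hv, Hv'. exact (cseries_unique _ _ _ (Hv' z Hz) (Hv z Hz)). }
  (* The dilatation condition is given for some decomposition [h'], [g'] of [f]; the Wirtinger
     derivatives of [f] carry it over to [h], [g]. *)
  assert (Huv : forall z, disk z -> Cmod (v z) < Cmod (u z)).
  { intros z Hz. destruct Hlu as [h' [g' [(Ah & Ag & _ & _ & Hf') Hlt]]]. specialize (Hlt z Hz).
    destruct (wirtinger f h g z (u z) (v z) Hf Hz (Dh z Hz) (Dg z Hz)) as [E1 E2].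
    destruct (wirtinger f h' g' z _ _ Hf' Hz (C_derive_correct h' z 0%C (Ah z Hz))
                (C_derive_correct g' z 0%C (Ag z Hz))) as [E3 E4].
    rewrite <- E1, E3, <- (Cmod_conj (v z)), <- E2, E4, Cmod_conj. exact Hlt. }
  assert (Hdec : harmonic_decomposition f h g u v) by (intros z Hz; auto).
  assert (H2 : forall z, disk z -> (exists l, cderive u z l) /\ (exists l, cderive v z l)).
  { destruct (power_series_derive _ _ Hu) as [u' [_ Du]].
    destruct (power_series_derive _ _ Hv) as [v' [_ Dv]].
    intros z Hz. split; eexists; eauto. }
  set (zeta := fun w => (Cconj e * (w / (1 + w)))%C).
  assert (Hs : shear (fun w => e * h (zeta w))%C (fun w => u (zeta w) * / ((1 + w) * (1 + w)))%C
                 (fun w => Cconj e * g (zeta w))%C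
                 (fun w => Cconj e * Cconj e * v (zeta w) * / ((1 + w) * (1 + w)))%C).
  { apply (shear_of_disk e h g u v); auto. }
  assert (HF : forall w, right_half w ->
            (e * h (zeta w) + Cconj (Cconj e * g (zeta w)))%C = (e * f (zeta w))%C).
  { intros w Hw. rewrite (Hf (zeta w) (right_half_to_disk e w He Hw)), Cmult_conj, Cconj_conj. ring. }
  set (omega := fun z => (e * z / (1 - e * z))%C).
  assert (Ho : forall z, disk z -> right_half (omega z) /\ zeta (omega z) = z).
  { intros z Hz. split; [now apply disk_to_right_half | now apply disk_right_half_disk]. }
  assert (Huniv : univalent f).
  { intros z w Hz Hw E. destruct (Ho z Hz) as [Hz1 Hz2]. destruct (Ho w Hw) as [Hw1 Hw2].
    rewrite <- Hz2, <- Hw2. f_equal. apply (shear_injective _ _ _ _ _ _ Hs Hz1 Hw1).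
    cbv beta. rewrite !HF, Hz2, Hw2, E by assumption. reflexivity. }
  split; [exact Huniv |]. split.
  - split; [exists (f 0%C), 0%C; split; [apply disk_0 | reflexivity] |].
    split; [exact (image_open f h g u v Hdec Huv Huniv) | exact (image_connected f h g u v Hdec)].
  - intros x. apply slice_connected.
    (* Multiplication by [e] makes the direction [- theta] horizontal: the parameter [t] becomes a
       shift of the real part, and [shear_slice] applies. *)
    assert (Hec : (e * cis (- theta))%C = 1%C).
    { unfold e. rewrite cis_plus, Rplus_opp_r. unfold cis. rewrite cos_0, sin_0. reflexivity. }
    assert (Hline : forall t, (e * (x + RtoC t * cis (- theta)))%C = (e * x + RtoC t)%C).
    { intros t. transitivity (e * x + RtoC t * (e * cis (- theta)))%C; [ring |]. rewrite Hec. ring. }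
    intros t1 t2 t Ht [z1 [Hz1 E1]] [z2 [Hz2 E2]].
    destruct (Ho z1 Hz1) as [K1 L1]. destruct (Ho z2 Hz2) as [K2 L2].
    destruct (shear_slice _ _ _ _ (omega z1) (omega z2) (Re (e * x)%C + t) Hs K1 K2)
      as [w [Hw Ew]].
    + cbv beta. rewrite !HF, L1, L2, E1, E2, !Hline by assumption. unfold Im; simpl. ring.
    + cbv beta. rewrite !HF, L1, L2, E1, E2, !Hline, !re_plus, !re_RtoC by assumption. lra.
    + cbv beta in Ew. rewrite !HF, L1, E1, Hline in Ew by assumption.
      exists (zeta w). split; [now apply right_half_to_disk |].
      assert (E : (e * f (zeta w))%C = (e * (x + RtoC t * cis (- theta)))%C).
      { rewrite Hline, Ew. apply injective_projections; unfold Re, Im; simpl; ring. }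
      transitivity (e * Cconj e * f (zeta w))%C; [rewrite Hee; ring |].
      transitivity (Cconj e * (e * f (zeta w)))%C; [ring |]. rewrite E.
      transitivity (e * Cconj e * (x + RtoC t * cis (- theta)))%C; [ring |]. rewrite Hee. ring.
Qed.
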